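(* Let $\rho\in(-1,1)$ and let $(X_1,X_2)$ be a bivariate random vector with stochastic representation $$(X_1,X_2)\stackrel{d}{=}R\bigl(U_1,\ \rho U_1+\sqrt{1-\rho^2}\,U_2\bigr),$$ where the positive random variable $R$ is independent of $(U_1,U_2)$ and $(U_1,U_2)$ is uniformly distributed on the unit circle of $\mathbb{R}^2$. Let $F$ be the distribution function of $R$, with $F(0)=0$ and $F(x)<1$ for all $x>0$, and assume that there is a positive function $w$ such that $$\lim_{u\to\infty}\frac{1-F(u+x/w(u))}{1-F(u)}=\exp(-x)\qquad\text{for all }x\in\mathbb{R}.$$ Set $\alpha_\rho:=\sqrt{2/(1+\rho)}>1$, let $Q$ be the (continuous) distribution function of $X_1$ (which is also that of $X_2$) with inverse $Q^{-1}$, and for $x,y>0$ and $u>0$ put $$\widetilde S_u(x,y):=\mathbf{P}\{Q(X_1)>1-x/u,\ Q(X_2)>1-y/u\},\qquad S_u(x,y):=\frac{\widetilde S_u(x,y)}{\widetilde S_u(1,1)}.$$ (i) If $\lim_{u\to\infty} w(\alpha_\rho u)/w(u)=\infty$, then $\lim_{u\to\infty}S_u(x,y)=\infty$ for all $x>1$, $y>1$, and $\lim_{u\to\infty}S_u(x,y)=0$ for all $x,y\in(0,1)$. (ii) If for some $\theta\in[0,\infty)$ we have $\lim_{u\to\infty} w(cu)/w(u)=c^{\theta-1}$ for all $c>0$, then for all $x,y\in(0,\infty)$ $$\lim_{u\to\infty}S_u(x,y)=(xy)^{1/(2\eta)},\qquad \eta:=\Bigl(\frac{1+\rho}{2}\Bigr)^{\theta/2}=\alpha_\rho^{-\theta}\in(0,1],$$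 and the function $u\mapsto\widetilde S_u(1,1)$ is regularly varying at infinity with index $-1/\eta$. (iii) As $u\to\infty$, $$\widetilde S_u(1,1)=(1+o(1))\,\frac{\alpha_\rho^2(1-\rho^2)^{3/2}}{2\pi(1-\rho)^2}\,\frac{1-F(b_*(u))}{b_*(u)\,w(b_*(u))},\qquad b_*(u):=\alpha_\rho\,Q^{-1}(1-1/u).$$
   Context: $\stackrel{d}{=}$ denotes equality in distribution. The assumption on $F$ and $w$ says that $F$ is in the Gumbel max-domain of attraction with scaling function $w$. A positive function $g$ is regularly varying at infinity with index $\gamma$ if $\lim_{u\to\infty}g(cu)/g(u)=c^\gamma$ for all $c>0$. Part (iii) is asserted under the general assumptions only (not under the extra hypotheses of (i) or (ii)). *)

(* Defs.v *)
From HB Require Import structures.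
From mathcomp Require Import all_boot all_order all_algebra.
From mathcomp Require Import all_classical all_reals all_analysis.

Set Implicit Arguments.
Unset Strict Implicit.
Unset Printing Implicit Defensive.

Import Order.TTheory GRing.Theory Num.Theory.
Import numFieldNormedType.Exports.

Local Open Scope classical_set_scope.
Local Open Scope ring_scope.

(* The laws are compared on measurable sets only: the values of a measure on
   other sets carry no meaning. *)
Definition eq_in_distribution (R : realType) (d1 d2 d : measure_display)
    (T1 : measurableType d1) (T2 : measurableType d2) (S : measurableType d)
    (P1 : probability T1 R) (X : T1 -> S)
    (P2 : probability T2 R) (Y : T2 -> S) : Prop :=
  forall A : set S, measurable A -> P1 (X @^-1` A) = P2 (Y @^-1` A).

Definition independent_of (R : realType) (d d1 d2 : measure_display)
    (T : measurableType d) (S1 : measurableType d1) (S2 : measurableType d2)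
    (P : probability T R) (X : T -> S1) (Y : T -> S2) : Prop :=
  forall (A : set S1) (B : set S2), measurable A -> measurable B ->
    P (X @^-1` A `&` Y @^-1` B) = (P (X @^-1` A) * P (Y @^-1` B))%E.

Lemma twopi_gt0 (R : realType) : 0 < 2 * pi :> R.
Proof. by rewrite mulr_gt0// pi_gt0. Qed.

(* Normalized arc length, through the parametrization of the circle by the
   angle. *)
Definition uniform_on_unit_circle (R : realType) (d : measure_display)
    (T : measurableType d) (P : probability T R) (U1 U2 : {RV P >-> R}) : Prop :=
  eq_in_distribution P (fun t => (U1 t, U2 t))
    (uniform_prob (twopi_gt0 R)) (fun a : R => (cos a, sin a)).

Definition rcdf (R : realType) (d : measure_display) (T : measurableType d)
    (P : probability T R) (X : {RV P >-> R}) (x : R) : R := fine (cdf X x).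

(* For a continuous strictly increasing Q with range ]0, 1[ this is the inverse
   of Q on ]0, 1[; outside ]0, 1[ the value is irrelevant. *)
Definition cdf_inverse (R : realType) (Q : R -> R) (p : R) : R :=
  inf [set x | p <= Q x].

Definition gumbel_mda (R : realType) (F w : R -> R) : Prop :=
  (forall u, 0 < u -> 0 < w u) /\
  forall x, (1 - F (u + x / w u)) / (1 - F u) @[u --> +oo] --> expR (- x).

Definition regularly_varying (R : realType) (g : R -> R) (gamma : R) : Prop :=
  (forall u, 0 < u -> 0 < g u) /\
  forall c, 0 < c -> g (c * u) / g u @[u --> +oo] --> c `^ gamma.

Definition alpha (R : realType) (rho : R) : R := Num.sqrt (2 / (1 + rho)).

Lemma alpha_gt1 (R : realType) (rho : R) : -1 < rho < 1 -> 1 < alpha rho.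
Proof.
move=> /andP[rho_gtN1 rho_lt1]; rewrite /alpha.
have rho1_gt0 : 0 < 1 + rho by rewrite -ltrBlDl sub0r.
rewrite -[X in X < _]sqrtr1 ltr_sqrt ?divr_gt0//.
by rewrite ltr_pdivlMr// mul1r -[X in _ < X]/(1 + 1) ltrD2l.
Qed.

Definition joint_tail (R : realType) (d : measure_display)
    (T : measurableType d) (P : probability T R) (X1 X2 : {RV P >-> R})
    (x y u : R) : R :=
  let Q := rcdf X1 in
  fine (P [set t | Q (X1 t) > 1 - x / u /\ Q (X2 t) > 1 - y / u]).

Definition joint_tail_ratio (R : realType) (d : measure_display)
    (T : measurableType d) (P : probability T R) (X1 X2 : {RV P >-> R})
    (x y u : R) : R :=
  joint_tail X1 X2 x y u / joint_tail X1 X2 1 1 u.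

(* Main.v *)
(* Let h be half the angle between the directions of X1 and X2, so that
   rho = cos (2 h) and alpha_rho = 1 / cos h. Conditioning on the angle, measured
   from the bisector of the two directions, gives
     P(X1 > a1, X2 > a2) = (1 / 2 pi) *
       int (1 - F (max (a1 / cos (t + h)) (a2 / cos (t - h)))) dt
   over the t for which both cosines are positive; h = 0 gives the marginal tail.
   Near t = 0 this integral is evaluated by Laplace's method: with B = b w(b) and
   both a_i about b cos h, the substitution t = v / B (t = v / sqrt B when h = 0)
   turns the integrand divided by 1 - F b into exp (- max (s + v tan h) (r - v tan h))
   in the limit (exp (- s - v^2 / 2) when h = 0). Domination comes from the
   quadratic decay of F on the scale 1 / w, a consequence of the self-neglecting
   property of 1 / w. Hence Q is again in the Gumbel domain with the same w, the
   quantiles of levels 1 - x / u and 1 - 1 / u differ by about - ln x / w on the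
   marginal scale, and comparing this scale with the scale 1 / w(b) of the joint
   tail gives the three limits. *)
Require Import Defs.
From HB Require Import structures.
From mathcomp Require Import all_boot all_order all_algebra.
From mathcomp Require Import all_classical all_reals all_analysis.
From mathcomp Require Import measurable_realfun.
From mathcomp Require Import ring lra.

Set Implicit Arguments.
Unset Strict Implicit.
Unset Printing Implicit Defensive.

Import Order.TTheory GRing.Theory Num.Theory.
Import numFieldNormedType.Exports.

Local Open Scope classical_set_scope.
Local Open Scope ring_scope.

(** * The Gumbel domain of attraction *)

(** [F] may have jumps and flat parts, so everything about it comes from the monotonicity of the
    tail and the one assumed limit, by sandwiching between shifted tails. The limit at each fixed
    shift does not control the integrand far from t = 0. The exponent of the rescaled integrand
    grows at least linearly in v, whatever h is, so quadratic decay of the tail already gives a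
    majorant K / (1 + v^2), the same for joint and marginal tails. Dominated convergence concerns
    sequences, so limits at infinity are tested on arbitrary sequences tending to infinity. The
    regularity of Q on the positive half-line comes from the angle: a fixed radius meets a vertical
    line in at most two points of the circle, and arbitrarily large radii occur with positive
    probability. In (i) the quantile shift has no finite limit on the scale of the joint tail, hence
    the comparisons by monotonicity there. In (ii) regular variation is the limit at x = y = 1 / c,
    because the joint tail depends on x / u and y / u only. *)

Section Gumbel.
Context {R : realType}.
Variables (F w : R -> R).
Hypothesis Fnd : {homo F : x y / x <= y}.
Hypothesis F_le0 : forall x, x <= 0 -> F x = 0.
Hypothesis F_lt1 : forall x, F x < 1.
Hypothesis tail_cvg0 : 1 - F u @[u --> +oo] --> 0.
Hypothesis FG : gumbel_mda F w.

Let tail x := 1 - F x.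

Let tail_gt0 x : 0 < tail x.
Proof. by rewrite subr_gt0. Qed.

Let tail_ni x y : x <= y -> tail y <= tail x.
Proof. by move=> xy; rewrite lerD2l lerN2 Fnd. Qed.

Let w_gt0 u : 0 < u -> 0 < w u.
Proof. exact: FG.1. Qed.

(** Monotonicity of the tail upgrades the limit at fixed shifts to convergent shifts: [s t] is
    eventually trapped between [l - d / 2] and [l + d / 2], and the exponential is continuous. *)
Lemma gumbel_cvg {T : Type} (G : set_system T) {FGf : Filter G} (b s : T -> R) (l : R) :
  b t @[t --> G] --> +oo -> s t @[t --> G] --> l ->
  tail (b t + s t / w (b t)) / tail (b t) @[t --> G] --> expR (- l).
Proof.
move=> boo sl.
have lim x : tail (b t + x / w (b t)) / tail (b t) @[t --> G] --> expR (- x).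
  exact: (cvg_comp _ _ boo (FG.2 x)).
apply/cvgrPdist_lt => e e0.
have e20 : 0 < e / 2 by lra.
have [d /= d0 dP] : nbhs_ball (- l) (fun y => `|expR (- l) - expR y| < e / 2).
  by apply/nbhs_ballP; exact: (cvgr_dist_lt _ _ (@continuous_expR R (- l)) _ e20).
have d2 : 0 < d / 2 by lra.
have h1 : `|expR (- l) - expR (- (l + d / 2))| < e / 2.
  by apply: dP; rewrite /ball/= (_ : _ - _ = d / 2) ?gtr0_norm//; [lra|ring].
have h2 : `|expR (- l) - expR (- (l - d / 2))| < e / 2.
  by apply: dP; rewrite /ball/= (_ : _ - _ = - (d / 2)) ?normrN ?gtr0_norm//; [lra|ring].
near=> t.
have bt : 0 < b t by near: t; exact: (boo _ (nbhs_pinfty_gt (num_real 0))).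
have wb := w_gt0 bt.
have : `|l - s t| < d / 2 by near: t; move: (d / 2) d2; apply/cvgrPdist_lt.
rewrite ltr_norml => /andP[l1 l2].
have : `|expR (- (l + d / 2)) - tail (b t + (l + d / 2) / w (b t)) / tail (b t)| < e / 2.
  by near: t; move: (e / 2) e20; apply/cvgrPdist_lt.
have : `|expR (- (l - d / 2)) - tail (b t + (l - d / 2) / w (b t)) / tail (b t)| < e / 2.
  by near: t; move: (e / 2) e20; apply/cvgrPdist_lt.
have m1 : tail (b t + (l + d / 2) / w (b t)) / tail (b t) <=
    tail (b t + s t / w (b t)) / tail (b t).
  by rewrite ler_pM2r ?invr_gt0// tail_ni// lerD2l ler_pM2r ?invr_gt0//; lra.
have m2 : tail (b t + s t / w (b t)) / tail (b t) <=
    tail (b t + (l - d / 2) / w (b t)) / tail (b t).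
  by rewrite ler_pM2r ?invr_gt0// tail_ni// lerD2l ler_pM2r ?invr_gt0//; lra.
move: h1 h2 m1 m2; rewrite !ltr_norml.
move=> /andP[? ?] /andP[? ?] ? ? /andP[? ?] /andP[? ?].
apply/andP; split; lra.
Unshelve. all: by end_near. Qed.

(** If [u * w u] stayed below [K], a shift by [- (|K| + 1) / w u] would land on the negative axis,
    where the tail is 1; the ratio to [tail u], which tends to 0, would then be unbounded. *)
Lemma gumbel_mulw_cvgy : u * w u @[u --> +oo] --> +oo.
Proof.
apply/cvgryPge => K.
pose x := - (`|K| + 1); pose B := expR (- x) + 1.
have B0 : 0 < B by rewrite addr_gt0// expR_gt0.
have Bx : expR (- x) < B by rewrite /B; lra.
have Bi0 : 0 < B^-1 by rewrite invr_gt0.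
near=> u.
have u0 : 0 < u by near: u; exact: (nbhs_pinfty_gt (num_real _)).
have wu := w_gt0 u0.
rewrite leNgt; apply/negP => uwK.
have K1 : K <= `|K| := ler_norm K.
have : (tail (u + x / w u)) / tail u < B by near: u; exact: (cvgr_lt _ (FG.2 x) _ Bx).
rewrite {1}/tail F_le0 ?subr0 ?mul1r.
  have : tail u < B^-1 by near: u; exact: (cvgr_lt _ tail_cvg0 _ Bi0).
  rewrite -div1r ltr_pdivlMr// => h1; rewrite invf_plt ?posrE// => h2.
  by move: h1; rewrite -ltr_pdivlMr// div1r => /(lt_trans h2); rewrite ltxx.
rewrite -(pmulr_lle0 _ wu) mulrDl divfK ?gt_eqF// /x; lra.
Unshelve. all: by end_near. Qed.

(** Were [1 / w] larger at [v u], a unit step from there would pass [u + (2 + e) / w u], where the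
    tail relative to [tail (v u)] is about exp (- 1 - e). But this step multiplies the tail by about
    exp (- 1); [m] separates the two. *)
Lemma gumbel_self_neglecting (e : R) : 0 < e ->
  \forall u \near +oo, (w (u + (w u)^-1))^-1 <= (1 + e) / w u.
Proof.
move=> e0.
pose v u := u + (w u)^-1.
have vy : v u @[u --> +oo] --> +oo.
  apply/cvgryPge => A; near=> u.
  have u0 : 0 < u by near: u; exact: (nbhs_pinfty_gt (num_real _)).
  apply: (@le_trans _ _ u); first by near: u; exact: (nbhs_pinfty_ge (num_real A)).
  by rewrite lerDl invr_ge0 ltW// w_gt0.
have c1 : tail (u + 1 / w u) / tail u @[u --> +oo] --> expR (-1) by exact: FG.2.
have c2 := FG.2 (2 + e).
have c3 : tail (v u + 1 / w (v u)) / tail (v u) @[u --> +oo] --> expR (-1).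
  exact: (cvg_comp _ _ vy (FG.2 1)).
pose m := expR (- 1 - e / 2).
have m0 : 0 < m by exact: expR_gt0.
have m3 : m < expR (-1) by rewrite ltr_expR; lra.
have c4 : (tail (u + (2 + e) / w u) / tail u) / (tail (u + 1 / w u) / tail u) @[u --> +oo]
    --> expR (- (2 + e)) / expR (-1).
  by apply: cvgM; [exact: c2|apply: cvgV; rewrite ?gt_eqF ?expR_gt0].
have m4 : expR (- (2 + e)) / expR (-1) < m.
  by rewrite -expRN -expRD ltr_expR; lra.
near=> u.
have u0 : 0 < u by near: u; exact: (nbhs_pinfty_gt (num_real _)).
have wu := w_gt0 u0.
have vu0 : 0 < v u by rewrite addr_gt0// invr_gt0.
have wv := w_gt0 vu0.
rewrite leNgt; apply/negP => lt.
have : m < tail (v u + 1 / w (v u)) / tail (v u) by near: u; exact: (cvgr_gt _ c3 _ m3).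
have : (tail (u + (2 + e) / w u) / tail u) / (tail (u + 1 / w u) / tail u) < m.
  by near: u; exact: (cvgr_lt _ c4 _ m4).
have -> : tail (u + (2 + e) / w u) / tail u / (tail (u + 1 / w u) / tail u)
   = tail (u + (2 + e) / w u) / tail (v u).
  rewrite /v mul1r; field; rewrite !gt_eqF//; exact: tail_gt0.
rewrite ltr_pdivrMr// ltr_pdivlMr// => h1 h2.
have := lt_trans h1 h2; rewrite ltNge => /negP; apply; apply: tail_ni.
rewrite (_ : u + (2 + e) / w u = v u + (1 + e) / w u); last first.
  by rewrite /v; field; rewrite gt_eqF.
by rewrite lerD2l div1r ltW.
Unshelve. all: by end_near. Qed.

(* Iterating [u |-> u + 1 / w u] at least halves the tail at each step, while
   by the self-neglecting property the step grows by a factor at most 5/4;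
   since (5/4)^2 <= 2, the tail decays quadratically. *)
Lemma gumbel_tail_decay : \forall u \near +oo, forall x : R, 0 < x ->
  tail (u + x / w u) <= 25 / x ^+ 2 * tail u.
Proof.
have e0 : 0 < 1 / 4 :> R by lra.
have h2 : expR (-1) < 1 / 2 :> R.
  by rewrite expRN div1r ltf_pV2 ?posrE ?expR_gt0// (le_lt_trans _ (expR_gt1Dx (oner_neq0 R))).
have [A [_ HA]] := gumbel_self_neglecting e0.
have [B [_ HB]] := cvgr_lt _ (FG.2 1) _ h2.
near=> u.
have uA : A < u by near: u; exact: (nbhs_pinfty_gt (num_real _)).
have uB : B < u by near: u; exact: (nbhs_pinfty_gt (num_real _)).
have u0 : 0 < u by near: u; exact: (nbhs_pinfty_gt (num_real _)).
have wu := w_gt0 u0.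
pose p (n : nat) : R := (5 / 4) ^+ n.
have p1 n : 1 <= p n by rewrite exprn_ege1//; lra.
have pS n : p n.+1 = 5 / 4 * p n by rewrite /p exprS.
(* [v] is the n-th iterate, and [4 * (p n - 1)] is the geometric sum of (5/4)^i over i < n, which
   bounds the distance covered in units of [1 / w u]. *)
have H (n : nat) : exists2 v, u <= v & [/\ tail v * p n ^+ 2 <= tail u, (w v)^-1 <= p n / w u &
     v <= u + 4 * (p n - 1) / w u].
  elim: n => [|n [v uv [t1 t2 t3]]].
    by exists u => //; split; rewrite ?/p ?expr0 ?expr1n ?mulr1 ?subrr ?mulr0 ?mul0r ?addr0// mul1r.
  have v0 : 0 < v by exact: lt_le_trans uv.
  have wv := w_gt0 v0.
  exists (v + (w v)^-1); first by rewrite (le_trans uv)// lerDl invr_ge0 ltW.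
  have := HB v (lt_le_trans uB uv); rewrite div1r ltr_pdivrMr ?tail_gt0// => /ltW hB.
  have := HA v (lt_le_trans uA uv) => /= hA.
  split.
  - rewrite pS exprMn.
    apply: le_trans t1; rewrite mulrA ler_wpM2r ?sqr_ge0//.
    have := tail_gt0 v.
    by rewrite /tail in hB *; lra.
  - apply: (le_trans hA); rewrite pS -mulrA (_ : 1 + 1 / 4 = 5 / 4); last by field.
    by rewrite mulrA -[leRHS]mulrA ler_pM2l//; lra.
  - rewrite pS; apply: (le_trans (lerD t3 t2)).
    rewrite -addrA lerD2l -mulrDl ler_pM2r ?invr_gt0//; have := p1 n; lra.
move=> x x0.
have [n [pn pn1]] : exists n, 4 * (p n - 1) <= x /\ x <= 4 * (p n.+1 - 1).
  have [N xN] : exists N, x <= 4 * (p N - 1).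
    have pn n : 1 + n%:R / 4 <= p n.
      elim: n => [|n IH]; first by rewrite /p expr0 mul0r addr0.
      by rewrite pS -natr1; have := ler0n R n; lra.
    have := archi_boundP (ltW x0); set N := Num.bound _ => xN.
    by exists N; have := pn N; lra.
  elim: N xN => [|N IH] xN; first by rewrite /p expr0 in xN; lra.
  by have [/IH//|/ltW ?] := leP x (4 * (p N - 1)); exists N.
have [v uv [t1 t2 t3]] := H n.
rewrite mulrAC ler_pdivlMr ?exprn_gt0//.
apply: (@le_trans _ _ (tail v * x ^+ 2)).
  rewrite ler_pM2r ?exprn_gt0// tail_ni//; apply: (le_trans t3).
  by rewrite lerD2l ler_pM2r ?invr_gt0.
(* 25 is the square of 5: x <= 4 (p (n+1) - 1) = 5 p n - 4 <= 5 p n. *)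
apply: (@le_trans _ _ (25 * (tail v * p n ^+ 2))); last by rewrite ler_pM2l.
rewrite (mulrCA 25) (ler_pM2l (tail_gt0 v)) (_ : 25 * p n ^+ 2 = (5 * p n) ^+ 2); last by ring.
rewrite ler_pXn2r ?nnegrE// ?ltW//; last by have := p1 n; lra.
by move: pn1; rewrite pS; lra.
Unshelve. all: by end_near. Qed.

(** The decay bound is useless near z = 0 and silent for z < 0. On [- M, 1] the tail is controlled
    by its value at the left end, and centring the denominator at [- M] gives one formula for both
    ranges. *)
Lemma gumbel_tail_bound (M : R) : 0 <= M -> exists2 K, 0 < K &
  \forall u \near +oo, forall z : R, - M <= z ->
    tail (u + z / w u) <= K / (1 + (z + M) ^+ 2) * tail u.
Proof.
move=> M0.
pose B := expR M + 1.
have B0 : 0 < B by rewrite addr_gt0// expR_gt0.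
have Bx : expR (- - M) < B by rewrite opprK /B; lra.
(* [C] bounds 1 + (z + M)^2 when - M <= z <= 1, and [C * z ^+ 2] bounds it when z > 1. *)
pose C := 1 + (M + 1) ^+ 2.
have C0 : 0 < C by have := sqr_ge0 (M + 1); rewrite /C; lra.
exists ((B + 25) * C); first by rewrite mulr_gt0//; lra.
near=> u => z Mz.
have u0 : 0 < u by near: u; exact: (nbhs_pinfty_gt (num_real _)).
have wu := w_gt0 u0.
have D0 : 0 < 1 + (z + M) ^+ 2 by have := sqr_ge0 (z + M); lra.
have [z1|z1] := leP z 1.
  have : tail (u + (- M) / w u) / tail u < B by near: u; exact: (cvgr_lt _ (FG.2 (- M)) _ Bx).
  rewrite ltr_pdivrMr// => /ltW h.
  apply: (@le_trans _ _ (tail (u + - M / w u))).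
    by rewrite tail_ni// lerD2l ler_pM2r ?invr_gt0.
  apply: (le_trans h); rewrite ler_pM2r// ler_pdivlMr//.
  apply: ler_pM; [lra|lra|lra|].
  rewrite /C lerD2l ler_pXn2r ?nnegrE//; lra.
have : tail (u + z / w u) <= 25 / z ^+ 2 * tail u.
  have z0 : 0 < z by lra.
  by apply: (near gumbel_tail_decay u).
move/le_trans; apply; rewrite ler_pM2r//.
have z20 : 0 < z ^+ 2 by rewrite exprn_gt0//; lra.
rewrite ler_pdivrMr// mulrAC ler_pdivlMr//.
have zM : 1 + (z + M) ^+ 2 <= C * z ^+ 2.
  rewrite /C mulrDl mul1r lerD//; first by rewrite exprn_ege1// ltW.
  have Mz1 : 0 <= M * (z - 1) by rewrite mulr_ge0//; lra.
  rewrite -exprMn ler_pXn2r ?nnegrE//; [lra|lra|].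
  by apply: mulr_ge0; lra.
have h25 : 0 <= 25 :> R by lra.
apply: (le_trans (ler_wpM2l h25 zM)).
by rewrite mulrA ler_pM2r// ler_pM2r//; lra.
Unshelve. all: by end_near. Qed.

End Gumbel.

(** * Affine substitution and dominated convergence *)

Section AffineSubstitution.
Context {R : realType}.
Local Notation mu := (@lebesgue_measure R).

(** Both sides are measures that agree on half-open intervals, which determine Lebesgue measure. *)
Lemma lebesgue_measure_affine (a b : R) (A : set R) : 0 < a -> measurable A ->
  mu A = (a%:E * pushforward mu (fun x : R => (a * x + b)%R : measurableTypeR R) A)%E.
Proof.
move=> a0 mA.
have mphi : @measurable_fun _ _ (measurableTypeR R) (measurableTypeR R) setT
    (fun x => a * x + b).
  by apply: measurable_funD => //; exact: measurable_funM.
suff : mu A = pushforward (mscale (NngNum (ltW a0)) mu)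
  (fun x : measurableTypeR R => (a * x + b)%R : measurableTypeR R) A.
  by rewrite /pushforward/mscale/= => ->.
apply: lebesgue_measure_unique => //= _ [[x y]] _ <-.
rewrite /mscale/= /pushforward/=.
rewrite (_ : _ @^-1` _ = `](x - b) / a, (y - b) / a]%classic); last first.
  by apply/seteqP; split=> z /=; rewrite !in_itv/= ltr_pdivrMr// ler_pdivlMr//
    ltrBlDr lerBrDr (mulrC z).
rewrite !lebesgue_measure_itv/= !lte_fin ltr_pM2r ?invr_gt0// ltrD2r.
case: ifPn => _; last by rewrite mule0.
by rewrite -!EFinD -EFinM; congr EFin; field; rewrite gt_eqF.
Qed.

Lemma ge0_integral_affine (f : R -> \bar R) (a b : R) : 0 < a ->
  measurable_fun [set: R] f -> (forall x, 0 <= f x)%E ->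
  (\int[mu]_x f x = a%:E * \int[mu]_x f (a * x + b)%R)%E.
Proof.
move=> a0 mf f0.
have mphi : @measurable_fun _ _ (measurableTypeR R) (measurableTypeR R) setT
    (fun x => a * x + b).
  by apply: measurable_funD => //; exact: measurable_funM.
rewrite (eq_measure_integral (pushforward (mscale (NngNum (ltW a0)) mu)
  (fun x : measurableTypeR R => (a * x + b)%R : measurableTypeR R))); last first.
  by move=> A mA _ /=; exact: lebesgue_measure_affine.
rewrite ge0_integral_pushforward// ge0_integral_mscale//=.
- by rewrite preimage_setT.
- by rewrite preimage_setT; exact: (measurableT_comp mf mphi).
Qed.

(* The interval [c - T, c[ is cut at 0 and its negative part moved by a
   period. *)
Lemma ge0_integral_periodic (f : R -> \bar R) (T c : R) : 0 <= c <= T ->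
  measurable_fun [set: R] f -> (forall x, 0 <= f x)%E -> (forall x, f (x + T) = f x) ->
  (\int[mu]_(x in `[0%R, T]) f x = \int[mu]_(x in `[(c - T)%R, c]) f x)%E.
Proof.
move=> /andP[c0 cT] mf f0 fT.
have mfT (A : set R) : measurable_fun A f by exact: measurable_funTS.
rewrite -!integral_itv_bndo_bndc//.
have split_itv (x y z : R) : x <= y <= z ->
    (\int[mu]_(t in `[x, z[) f t =
     \int[mu]_(t in `[x, y[) f t + \int[mu]_(t in `[y, z[) f t)%E.
  move=> /andP[xy yz].
  rewrite -ge0_integral_setU//=.
  - by rewrite -itv_bndbnd_setU// bnd_simp.
  - exact: mfT.
  - apply/disj_setPS => t /= []; rewrite !in_itv/= => /andP[_ h1] /andP[h2 _].
    by move: (lt_le_trans h1 h2); rewrite ltxx.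
rewrite (split_itv 0 c T) ?c0// (split_itv (c - T) 0 c); last first.
  by apply/andP; split; lra.
rewrite addeC; congr (_ + _)%E.
rewrite integral_mkcond [RHS]integral_mkcond.
rewrite (@ge0_integral_affine _ 1 T)//; last first.
- by move=> x; rewrite patchE; case: ifPn.
- exact: (measurable_restrictT _ _).1.
rewrite mul1e; apply: eq_integral => x _; rewrite !patchE mul1r fT !mem_setE.
by rewrite !in_itv/= lerBlDr -[X in _ < X]add0r ltrD2r.
Qed.

End AffineSubstitution.

(** * Laplace's method for Gumbel tails *)

Section Laplace.
Context {R : realType}.
Local Notation mu := (@lebesgue_measure R).
Variables (F w : R -> R).
Hypothesis Fnd : {homo F : x y / x <= y}.
Hypothesis F_lt1 : forall x, F x < 1.
Hypothesis FG : gumbel_mda F w.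

Let tail x := 1 - F x.

Let tail_gt0 x : 0 < tail x.
Proof. by rewrite subr_gt0. Qed.

Let tail_ni x y : x <= y -> tail y <= tail x.
Proof. by move=> xy; rewrite lerD2l lerN2 Fnd. Qed.

Lemma integrable_oneDsqrV (K : R) : mu.-integrable [set: R] (fun v => (K * (oneDsqr v)^-1)%:E).
Proof.
have mf : measurable_fun [set: R] (fun v : R => (oneDsqr v)^-1).
  by apply: continuous_measurable_fun; exact: continuous_oneDsqrV.
rewrite (_ : (fun _ => _) = (fun v => K%:E * (oneDsqr v)^-1%:E)%E); last first.
  by apply/funext => v; rewrite EFinM.
apply: integrableZl => //; apply/integrableP; split; first exact/measurable_EFinP.
under eq_integral do rewrite gee0_abs ?lee_fin ?invr_ge0 ?(le_trans ler01 (oneDsqr_ge1 _))//.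
rewrite ge0_symfun_integralT.
- rewrite (_ : [set x | _] = `[0, +oo[%classic); last first.
    by apply/seteqP; split => x/=; rewrite in_itv/= andbT.
  by rewrite integral0y_oneDsqr -EFinM ltry.
- by move=> x; rewrite invr_ge0 (le_trans ler01 (oneDsqr_ge1 _)).
- exact: continuous_oneDsqrV.
- by move=> x/=; rewrite /oneDsqr sqrrN.
Qed.

(** [D n] is the rescaled domain of integration, which eventually contains every point, and [Zn n]
    is the position of the integrand's argument relative to [b n] in units of [1 / w (b n)]. The
    lower bound [c * |v| - M] is exactly what turns [gumbel_tail_bound] into an integrable
    majorant. *)
Lemma gumbel_laplace (b : R^nat) (g Zn : nat -> R -> R) (Z : R -> R)
    (D : nat -> set R) (c M : R) :
  b n @[n --> \oo] --> +oo -> 0 < c -> 0 <= M ->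
  (forall n, measurable_fun [set: R] (g n)) ->
  (\forall n \near \oo, forall v, D n v ->
    g n v = tail (b n + Zn n v / w (b n)) / tail (b n)) ->
  (forall n v, ~ D n v -> g n v = 0) ->
  (forall v, \forall n \near \oo, D n v) ->
  (forall v, Zn n v @[n --> \oo] --> Z v) ->
  (\forall n \near \oo, forall v, D n v -> c * `|v| - M <= Zn n v) ->
  measurable_fun [set: R] Z ->
  (\int[mu]_v (g n v)%:E @[n --> \oo] --> \int[mu]_v (expR (- Z v))%:E)%E.
Proof.
move=> boo c0 M0 mg gD gND Dv ZnZ ZnM mZ.
have [K K0 HK] := gumbel_tail_bound Fnd F_lt1 FG M0.
(* The majorant is valid only from some rank [N] on, so dominated convergence is applied to the
   shifted sequence. *)
have [N _ HN] : \forall n \near \oo, (forall v, D n v -> c * `|v| - M <= Zn n v) /\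
    (forall v, D n v -> g n v = tail (b n + Zn n v / w (b n)) / tail (b n)) /\
    0 < b n /\ forall z, - M <= z ->
      tail (b n + z / w (b n)) <= K / (1 + (z + M) ^+ 2) * tail (b n).
  have h1 : \forall n \near \oo, 0 < b n := boo _ (nbhs_pinfty_gt (num_real 0)).
  have h2 := boo _ HK.
  near=> n; split; first by near: n.
  split; first by near: n.
  by split; near: n; [exact: h1|exact: h2].
(* This factor absorbs the slope [c]: (1 + c^-2) (1 + c^2 v^2) >= 1 + v^2. *)
pose K' := K * (1 + c ^- 2).
have mf_ n : measurable_fun [set: R] (fun v => (g (n + N)%N v)%:E).
  by apply/measurable_EFinP; exact: mg.
have mf : measurable_fun [set: R] (fun v => (expR (- Z v))%:E).
  apply/measurable_EFinP; apply: measurableT_comp => //; exact: measurableT_comp.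
have f_f : {ae mu, forall v, [set: R] v ->
    (g (n + N)%N v)%:E @[n --> \oo] --> (expR (- Z v))%:E}.
  apply: aeW => v _; apply/fine_cvgP; split; first exact: nearW.
  rewrite (_ : fine \o _ = fun n => g (n + N)%N v)//.
  rewrite (cvg_shiftn N (fun n => g n v)).
  apply: (cvg_trans _ (gumbel_cvg Fnd F_lt1 FG boo (ZnZ v))).
  apply: near_eq_cvg; near=> n.
  have gDn : forall v, D n v -> g n v = tail (b n + Zn n v / w (b n)) / tail (b n).
    by near: n.
  by rewrite gDn//; near: n; exact: Dv.
have f_g : {ae mu, forall v n, [set: R] v ->
    `|(g (n + N)%N v)%:E| <= (K' * (oneDsqr v)^-1)%:E}%E.
  apply: aeW => v n _; rewrite lee_fin.
  have K'0 : 0 < K' * (oneDsqr v)^-1.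
    have cc : 0 < c ^- 2 by rewrite invr_gt0 exprn_gt0.
    rewrite divr_gt0 ?mulr_gt0 ?(lt_le_trans ltr01 (oneDsqr_ge1 _))//; lra.
  have [Dn|Dn] := pselect (D (n + N)%N v); last by rewrite gND// normr0 ltW.
  have /HN[h1 [gDn [h2 h3]]] : (N <= n + N)%N by exact: leq_addl.
  have h4 := h1 _ Dn.
  rewrite gDn// ger0_norm; last by rewrite divr_ge0// ltW.
  rewrite ler_pdivrMr//.
  have cv : 0 <= c * `|v| by rewrite mulr_ge0// ltW.
  have h5 : - M <= c * `|v| - M by lra.
  apply: (@le_trans _ _ (tail (b (n + N)%N + (c * `|v| - M) / w (b (n + N)%N)))).
    by rewrite tail_ni// lerD2l ler_pM2r ?invr_gt0// FG.1.
  apply: (le_trans (h3 _ h5)); rewrite subrK ler_pM2r//.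
  rewrite /K' -mulrA ler_pM2l// ler_pdivlMr; last first.
    by rewrite (lt_le_trans ltr01 (oneDsqr_ge1 _)).
  rewrite mulrC ler_pdivrMr; last by have := sqr_ge0 (c * `|v|); lra.
  rewrite exprMn -normrX ger0_norm ?sqr_ge0// /oneDsqr.
  have : 0 <= v ^+ 2 by exact: sqr_ge0.
  have : 0 < c ^- 2 by rewrite invr_gt0 exprn_gt0.
  have : 0 <= c ^+ 2 * v ^+ 2 by rewrite mulr_ge0 ?sqr_ge0.
  have -> : (1 + c ^- 2) * (1 + c ^+ 2 * v ^+ 2) = 1 + c ^+ 2 * v ^+ 2 + c ^- 2 + v ^+ 2.
    by field; rewrite gt_eqF.
  lra.
have [_ _ h2] := @dominated_convergence _ _ _ mu _ measurableT _ _ _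
  mf_ mf f_f (integrable_oneDsqrV K') f_g.
rewrite -(cvg_shiftn N (fun n => (\int[mu]_v (g n v)%:E)%E)).
exact: h2.
Unshelve. all: by end_near. Qed.

End Laplace.

(** * The sector integral *)

Section Trigo.
Context {R : realType}.
Implicit Types x c : R.

(** This is x <= tan x cleared of its denominator, hence valid at pi / 2 as well; by the mean value
    theorem sin x = x cos xi with xi < x. *)
Lemma sin_ge_mul_cos x : 0 <= x <= pi / 2 -> x * cos x <= sin x.
Proof.
move=> /andP[]; rewrite le_eqVlt => /predU1P[<-|x0 xpi]; first by rewrite mul0r sin0.
have [xi] := @MVT R sin cos 0 x x0 (fun y _ => is_derive_sin y)
  (continuous_subspaceT (@continuous_sin R)).
rewrite in_itv/= sin0 !subr0 => /andP[xi0 xix] ->.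
have pi0 := pi_gt0 R.
rewrite mulrC ler_pM2r// leNgt ltr_cos ?in_itv/= -?leNgt//; first exact: ltW.
- by apply/andP; split; lra.
- by apply/andP; split; lra.
Qed.

(** Doubling the angle: sin x = 2 cos (x/2) sin (x/2) >= x cos (x/2)^2, and 2 cos (x/2)^2 = 1 + cos
    x >= 1. *)
Lemma sin_ge_half x : 0 <= x <= pi / 2 -> x / 2 <= sin x.
Proof.
move=> /andP[x0 xpi]; have pi0 := pi_gt0 R.
have := @sin_ge_mul_cos (x / 2); rewrite (_ : 0 <= x / 2 <= pi / 2); last first.
  by apply/andP; split; lra.
move=> /(_ isT) h.
have -> : sin x = 2 * (cos (x / 2) * sin (x / 2)).
  by rewrite [in LHS](_ : x = (x / 2) *+ 2) ?sin_mulr2n ?mulr_natl//; field.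
have cx : cos x = 2 * cos (x / 2) ^+ 2 - 1.
  by rewrite [in LHS](_ : x = (x / 2) *+ 2) ?cos_mulr2n ?mulr_natl//; field.
have c0 : 0 <= cos x by apply: cos_ge0_pihalf; apply/andP; split; lra.
have c20 : 0 <= cos (x / 2) by apply: cos_ge0_pihalf; apply/andP; split; lra.
have := ler_wpM2l c20 h; nra.
Qed.

Lemma onem_cosE x : 1 - cos x = 2 * sin (x / 2) ^+ 2.
Proof.
rewrite [in LHS](_ : x = (x / 2) *+ 2) ?cos_mulr2n; last by rewrite -mulr_natl; field.
by rewrite sin2cos2 -mulr_natl; ring.
Qed.

Lemma onem_cos_ge x : 0 <= x <= pi / 2 -> x ^+ 2 / 8 <= 1 - cos x.
Proof.
move=> /andP[x0 xpi]; have pi0 := pi_gt0 R; rewrite onem_cosE.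
have : x / 2 / 2 <= sin (x / 2) by apply: sin_ge_half; apply/andP; split; lra.
move=> h; have : (x / 2 / 2) ^+ 2 <= sin (x / 2) ^+ 2 by rewrite ler_pXn2r ?nnegrE//; lra.
lra.
Qed.

Lemma cos_gt0_lt_pihalf x : 0 <= x <= pi -> 0 < cos x -> x < pi / 2.
Proof.
move=> /andP[x0 xpi] cx; have pi0 := pi_gt0 R.
rewrite ltNge; apply/negP => px; move: cx; rewrite ltNge => /negP; apply.
rewrite -cos_pihalf leNgt ltr_cos -?leNgt//; rewrite in_itv/=; apply/andP; split; lra.
Qed.

Lemma cvg_sin_div c : sin (c * x) / x @[x --> 0^'] --> c.
Proof.
have h : is_derive (0 : R) 1 (fun x => sin (c * x)) c.
  apply: is_derive_eq.
  by rewrite mulr0 cos0 !scaler1 ?scale1r /GRing.scale/= ?mulr1 ?mul1r ?addr0.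
have := @ex_derive _ _ _ _ _ _ _ h; rewrite /derivable => /cvg_ex[l hl].
have := @derive_val _ _ _ _ _ _ _ h; rewrite /derive => hl2.
have e := cvg_lim (@Rhausdorff R) hl.
have lc : l = c by rewrite -hl2 e.
rewrite -[X in _ --> X]lc; apply: cvg_trans hl; apply: near_eq_cvg; near=> x.
by rewrite /= mulr0 sin0 subr0 addr0 /GRing.scale/= !mulr1 mulrC.
Unshelve. all: by end_near. Qed.

End Trigo.

(* With the angle measured from the bisector of the directions of X1 and X2,
   which are at angles -h and h, this is the conditional probability given the
   angle [t] that X1 > a1 and X2 > a2. *)
Definition wedge {R : realType} (F : R -> R) (h a1 a2 t : R) : R :=
  if [&& - pi <= t, t <= pi, 0 < cos (t + h) & 0 < cos (t - h)]
  then 1 - F (Num.max (a1 / cos (t + h)) (a2 / cos (t - h))) else 0.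

Lemma cvg_maxr {R : realType} {T : Type} (G : set_system T) {FG : Filter G}
    (f g : T -> R) (a b : R) :
  f t @[t --> G] --> a -> g t @[t --> G] --> b -> Num.max (f t) (g t) @[t --> G] --> Num.max a b.
Proof.
move=> fa gb.
have maxE (x y : R) : Num.max x y = (x + y + `|x - y|) / 2.
  by case: (leP x y) => xy; [rewrite ler0_norm|rewrite gtr0_norm]; lra.
under eq_fun do rewrite maxE.
rewrite maxE; apply: cvgM; last exact: cvg_cst.
by apply: cvgD; [exact: cvgD|apply: cvg_norm; exact: cvgB].
Qed.

Section WedgeMeasurable.
Context {R : realType}.
Variables (F : R -> R).
Hypothesis Fnd : {homo F : x y / x <= y}.

Lemma measurable_wedge h a1 a2 : measurable_fun [set: R] (wedge F h a1 a2).
Proof.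
have mcos (k : R) : measurable_fun [set: R] (fun t => cos (t + k)).
  apply: (measurableT_comp (continuous_measurable_fun (@continuous_cos R))).
  exact: measurable_funD.
(* The power of exponent -1 equals the inverse where the cosine is positive, the only place where
   [wedge] divides by it. *)
have mdiv (a k : R) : measurable_fun [set: R] (fun t => a * cos (t + k) `^ (-1)).
  apply: measurable_funM => //; exact: (measurableT_comp (measurable_powR (- 1)) (mcos k)).
have mF : measurable_fun [set: R] F by exact: nondecreasing_measurable.
rewrite (_ : wedge F h a1 a2 = fun t =>
  if [&& - pi <= t, t <= pi, 0 < cos (t + h) & 0 < cos (t + - h)]
  then 1 - F (Num.max (a1 * cos (t + h) `^ (-1)) (a2 * cos (t + - h) `^ (-1))) else 0);
  last first.
  apply/funext => t; rewrite /wedge; case: ifP => // /and4P[_ _ c1 c2].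
  by rewrite !powR_inv1// ltW.
apply: measurable_fun_ifT => //.
- apply: measurable_and; first exact: measurable_fun_ler.
  apply: measurable_and; first exact: measurable_fun_ler.
  apply: measurable_and; exact: measurable_fun_ltr.
- apply: measurable_funB => //; apply: (measurableT_comp mF).
  exact: measurable_maxr.
Qed.
End WedgeMeasurable.

(** * Laplace's method for the sector integral, uniformly in h *)

Section WedgeLaplace.
Context {R : realType}.
Local Notation mu := (@lebesgue_measure R).
Variables (F w : R -> R).
Hypothesis Fnd : {homo F : x y / x <= y}.
Hypothesis F_le0 : forall x, x <= 0 -> F x = 0.
Hypothesis F_lt1 : forall x, F x < 1.
Hypothesis tail_cvg0 : 1 - F u @[u --> +oo] --> 0.
Hypothesis FG : gumbel_mda F w.

Lemma cos_div_cosD (h t : R) : 0 < cos h ->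
  cos (t + h) = cos h * (cos t - tan h * sin t).
Proof. by move=> h0; rewrite cosD /tan; field; rewrite gt_eqF. Qed.

(** Dividing by [k <= 1] may magnify a negative [q]. For [k] at least 1/2 the loss is at most
    [2 * S]; for smaller [k] the term [B * (1 - k)] exceeds [S], since [2 * S < B]. *)
Lemma div_ge_sub_bound (B S q k z : R) : 0 < k <= 1 -> `|q| < S -> 2 * S < B ->
  z <= B * (1 - k) -> z - 2 * S <= (q + B * (1 - k)) / k.
Proof.
move=> /andP[k0 k1] qS BS zB; rewrite ler_pdivlMr//.
move: qS; rewrite ltr_norml => /andP[q1 q2].
have e1 : 0 <= (B - 2 * S) * (1 - k) ^+ 2 by rewrite mulr_ge0 ?sqr_ge0//; lra.
have e2 : 0 <= S * (k - 1 / 2) ^+ 2 by rewrite mulr_ge0 ?sqr_ge0//; lra.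
have e3 := ler_wpM2r (ltW k0) zB.
lra.
Qed.

(** The scale [lam] and the limit exponent [L] are left abstract so that h > 0, with a linear [L],
    and h = 0, with a quadratic one, are instances of one statement. By symmetry about the bisector,
    hypotheses on one cosine cover the other through v -> - v. *)
Lemma wedge_laplace (h c M0 : R) (b s r lam : R^nat) (sl rl : R) (L : R -> R) :
  0 <= h < pi / 2 -> 0 < c -> 0 <= M0 ->
  b n @[n --> \oo] --> +oo -> s n @[n --> \oo] --> sl -> r n @[n --> \oo] --> rl ->
  lam n @[n --> \oo] --> 0 -> (\forall n \near \oo, 0 < lam n) ->
  measurable_fun [set: R] L ->
  (forall v, b n * w (b n) * (1 - (cos (lam n * v) - tan h * sin (lam n * v)))
     @[n --> \oo] --> L v) ->
  (\forall n \near \oo, forall v : R, 0 <= v -> lam n * v <= pi / 2 ->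
     c * v - M0 <= b n * w (b n) * (1 - (cos (lam n * v) - tan h * sin (lam n * v)))) ->
  (\int[mu]_v (wedge F h ((b n + s n / w (b n)) * cos h) ((b n + r n / w (b n)) * cos h)
      (lam n * v) / (1 - F (b n)))%:E
   @[n --> \oo] --> \int[mu]_v (expR (- Num.max (sl + L v) (rl + L (- v))))%:E)%E.
Proof.
move=> /andP[h0 hpi] c0 M00 boo ssl rrl lam0 lamgt0 mL BL BM.
have pi0 := pi_gt0 R.
have ch : 0 < cos h by apply: cos_gt0_pihalf; apply/andP; split; lra.
have th : 0 <= tan h.
  apply: divr_ge0; last exact: ltW.
  by apply: sin_ge0_pi; apply/andP; split; lra.
pose k t : R := cos t - tan h * sin t.
have kE t : cos (t + h) = cos h * k t by exact: cos_div_cosD.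
have kNE t : cos (t - h) = cos h * k (- t).
  by rewrite -cosN opprB addrC -kE.
pose B n := b n * w (b n).
have Boo : B n @[n --> \oo] --> +oo.
  exact: (cvg_comp _ _ boo (gumbel_mulw_cvgy F_le0 F_lt1 tail_cvg0 FG)).
(* From cos (t + h) = cos h * k t one gets (b + s / w) cos h / cos (t + h) = b + ((s + B (1 - k t))
   / k t) / w. *)
pose Zn n v := Num.max ((s n + B n * (1 - k (lam n * v))) / k (lam n * v))
                       ((r n + B n * (1 - k (lam n * - v))) / k (lam n * - v)).
pose D n : set R := [set v | [&& - pi <= lam n * v, lam n * v <= pi,
   0 < cos (lam n * v + h) & 0 < cos (lam n * v - h)]].
pose S : R := `|sl| + `|rl| + 1.
have lamv v : lam n * v @[n --> \oo] --> 0.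
  by rewrite -[X in _ --> X](mul0r v); apply: cvgM => //; exact: cvg_cst.
have kcvg v : k (lam n * v) @[n --> \oo] --> (1 : R).
  have -> : (1 : R) = cos 0 - tan h * sin 0 by rewrite cos0 sin0 mulr0 subr0.
  apply: cvgB; first exact: (cvg_comp _ _ (lamv v) (@continuous_cos R 0)).
  by apply: cvgM; [exact: cvg_cst|exact: (cvg_comp _ _ (lamv v) (@continuous_sin R 0))].
have bpos : \forall n \near \oo, 0 < b n := boo _ (nbhs_pinfty_gt (num_real 0)).
apply: (gumbel_laplace Fnd F_lt1 FG (b := b) (Zn := Zn) (D := D) (c := c) (M := M0 + 2 * S)) => //.
- by rewrite addr_ge0// mulr_ge0// /S addr_ge0// addr_ge0.
- move=> n; apply: measurable_funM => //.
  by apply: measurableT_comp; [exact: measurable_wedge|exact: measurable_funM].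
- near=> n => v; rewrite /D/= => Dv; rewrite /wedge Dv.
  have b0 : 0 < b n by near: n.
  have wb := FG.1 _ b0.
  have /and4P[_ _] := Dv; rewrite kE kNE !pmulr_rgt0// -mulrN => k1 k2.
  congr ((1 - F _) / _).
  rewrite /Zn maxr_pMl ?invr_ge0 ?ltW// addr_maxr.
  by congr Num.max; rewrite /B; field; rewrite !gt_eqF.
- by move=> n v; rewrite /D/= => /negP/negbTE Dv; rewrite /wedge Dv mul0r.
- move=> v.
  near=> n.
  have l1 : `|lam n * v| < pi.
    near: n; apply: (cvgr_lt _ (cvg_norm (lamv v))); by rewrite normr0.
  have k1 : 0 < k (lam n * v) by near: n; exact: (cvgr_gt _ (kcvg v) _ ltr01).
  have k2 : 0 < k (lam n * - v) by near: n; exact: (cvgr_gt _ (kcvg (- v)) _ ltr01).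
  move: l1; rewrite ltr_norml => /andP[l1 l2].
  by rewrite /D/= (ltW l1) (ltW l2) kE kNE -mulrN !mulr_gt0.
- move=> v; apply: cvg_maxr.
    rewrite -[X in _ --> X]divr1; apply: cvgM; last by apply: cvgV => //; exact: kcvg.
    by apply: cvgD => //; exact: BL.
  rewrite -[X in _ --> X]divr1; apply: cvgM; last by apply: cvgV => //; exact: kcvg.
  by apply: cvgD => //; exact: BL.
- near=> n => v Dv.
  have b0 : 0 < b n by near: n.
  have l0 : 0 < lam n by near: n.
  have BS : 2 * S < B n by near: n; exact: (Boo _ (nbhs_pinfty_gt (num_real _))).
  have sS : `|s n| < S.
    near: n; apply: (cvgr_lt _ (cvg_norm ssl)); rewrite /S; have := normr_ge0 rl; lra.
  have rS : `|r n| < S.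
    near: n; apply: (cvgr_lt _ (cvg_norm rrl)); rewrite /S; have := normr_ge0 sl; lra.
  have BMn : forall v' : R, 0 <= v' -> lam n * v' <= pi / 2 ->
      c * v' - M0 <= B n * (1 - k (lam n * v')).
    by near: n; exact: BM.
  have key (q v' : R) : `|q| < S -> 0 <= v' -> lam n * v' < pi / 2 -> 0 < k (lam n * v') ->
      c * v' - (M0 + 2 * S) <= (q + B n * (1 - k (lam n * v'))) / k (lam n * v').
    move=> qS v0 lv kpos.
    have t0 : 0 <= lam n * v' by rewrite mulr_ge0// ltW.
    have k1 : k (lam n * v') <= 1.
      rewrite /k; have := cos_le1 (lam n * v').
      have st : 0 <= sin (lam n * v').
        by rewrite sin_ge0_pi// t0 (le_trans (ltW lv))// ler_pdivrMr// ler_pMr// ler1n.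
      by move=> c1; rewrite lerBlDr (le_trans c1)// lerDl mulr_ge0.
    have := BMn _ v0 (ltW lv).
    have -> : c * v' - (M0 + 2 * S) = c * v' - M0 - 2 * S by rewrite opprD addrA.
    by move=> zB; apply: div_ge_sub_bound => //; rewrite kpos.
  move: (Dv); rewrite /D/= => /and4P[p1 p2].
  rewrite kE kNE !pmulr_rgt0// -mulrN => k1 k2.
  (* k t + k (- t) = 2 cos t: positivity of both directions confines t to ]- pi/2, pi/2[, where the
     lower bound on the exponent is assumed. *)
  have cpos : 0 < cos (lam n * v).
    have := addr_gt0 k1 k2; rewrite /k mulrN cosN sinN mulrN opprK addrCA subrK.
    by rewrite -mulr2n pmulrn_lgt0.
  (* One argument of the maximum suffices: the one whose cosine decreases as t moves from 0 towards
     [lam n * v]. *)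
  rewrite /Zn le_max.
  have [v0|v0] := leP 0 v.
    rewrite ger0_norm// key//.
    by apply: cos_gt0_lt_pihalf => //; rewrite mulr_ge0 ?p2// ltW.
  rewrite ltr0_norm// key ?orbT ?oppr_ge0// ?ltW//.
  rewrite mulrN; apply: cos_gt0_lt_pihalf; last by rewrite cosN.
  by rewrite lerNl p1 andbT -mulrN mulr_ge0 ?oppr_ge0// ltW.
- apply: measurable_maxr; apply: measurable_funD => //.
  exact: measurableT_comp.
Unshelve. all: by end_near. Qed.
End WedgeLaplace.

(** * Closed forms of the limit integrals *)

Section Integrals.
Context {R : realType}.
Local Notation mu := (@lebesgue_measure R).

Lemma integral_expRN_norm (a : R) : 0 < a ->
  (\int[mu]_v (expR (- (a * `|v|)))%:E = (2 / a)%:E)%E.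
Proof.
move=> a0.
rewrite ge0_symfun_integralT; last 3 first.
- by move=> v; exact: expR_ge0.
- move=> v; apply: continuous_comp; last exact: continuous_expR.
  apply: cvgN; apply: cvgM; first exact: cvg_cst.
  exact: norm_continuous.
- by move=> v /=; rewrite normrN.
rewrite (_ : [set x | _] = `[0, +oo[%classic); last first.
  by apply/seteqP; split => x/=; rewrite in_itv/= andbT.
have := integral_exponential_pdf (rate := a) a0.
rewrite (_ : (fun x => (exponential_pdf a x)%:E) =
   (fun x => (a * expR (- (a * `|x|)))%:E) \_ `[0%R, +oo[); last first.
  apply/funext => x; rewrite /exponential_pdf !patchE; case: ifPn => //.
  by rewrite inE/= in_itv/= andbT => x0; rewrite ger0_norm// mulNr.
rewrite -integral_mkcond.
under eq_integral do rewrite EFinM.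
rewrite ge0_integralZl_EFin//=; last 2 first.
- apply/measurable_EFinP; apply: measurableT_comp => //; apply: measurableT_comp => //.
  apply: measurable_funM => //; exact: measurableT_comp.
- exact: ltW.
set X := (\int[mu]_(x in _) _)%E => h.
have -> : X = (a^-1)%:E.
  by rewrite -[RHS]mule1 -h muleA -EFinM mulVf ?mul1e// gt_eqF.
by rewrite -EFinM.
Qed.

Lemma integral_expRN_max (t s r : R) : 0 < t ->
  (\int[mu]_v (expR (- Num.max (s + t * v) (r + t * - v)))%:E =
   (2 / t * expR (- ((s + r) / 2)))%:E)%E.
Proof.
move=> t0.
(* At [v0] the two arguments of the maximum coincide, with value (s + r) / 2; centred there, the
   maximum is (s + r) / 2 + t |v|. *)
pose v0 := (r - s) / (2 * t).
rewrite (@ge0_integral_affine _ _ 1 v0)//; last first.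
  apply/measurable_EFinP; apply: measurableT_comp => //; apply: measurableT_comp => //.
  apply: measurable_maxr; apply: measurable_funD => //; apply: measurable_funM => //.
rewrite mul1e (_ : (fun v => _) =
    (fun v => (expR (- ((s + r) / 2)))%:E * (expR (- (t * `|v|)))%:E)%E); last first.
  apply/funext => v; rewrite -EFinM -expRD; congr (expR _)%:E.
  have -> : s + t * (1 * v + v0) = (s + r) / 2 + t * v by rewrite /v0; field; rewrite gt_eqF.
  have -> : r + t * - (1 * v + v0) = (s + r) / 2 + t * - v by rewrite /v0; field; rewrite gt_eqF.
  by rewrite -addr_maxr -maxr_pMr ?ltW// maxrN opprD.
rewrite ge0_integralZl_EFin ?expR_ge0//=.
- by rewrite integral_expRN_norm// -EFinM mulrC.
- apply/measurable_EFinP; apply: measurableT_comp => //; apply: measurableT_comp => //.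
  apply: measurable_funM => //; exact: measurableT_comp.
Qed.

Lemma integral_expRN_sqr (s : R) :
  (\int[mu]_v (expR (- (s + v ^+ 2 / 2)))%:E =
   (expR (- s) * (Num.sqrt 2 * Num.sqrt pi))%:E)%E.
Proof.
have s2 : 0 < Num.sqrt 2 :> R by rewrite sqrtr_gt0.
rewrite (@ge0_integral_affine _ _ (Num.sqrt 2) 0)//; last first.
  apply/measurable_EFinP; apply: measurableT_comp => //; apply: measurableT_comp => //.
  apply: measurable_funD => //; apply: measurable_funM => //; exact: measurable_funX.
rewrite (_ : (fun v => _) = (fun v => (expR (- s))%:E * (gauss_fun v)%:E)%E); last first.
  apply/funext => v; rewrite -EFinM /gauss_fun -expRD; congr (expR _)%:E.
  by rewrite addr0 exprMn sqr_sqrtr//; field.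
rewrite ge0_integralZl_EFin ?expR_ge0//=.
- by rewrite integralT_gauss -!EFinM mulrCA.
- by move=> x _; rewrite lee_fin gauss_fun_ge0.
- by apply/measurable_EFinP; exact: measurable_gauss_fun.
Qed.

End Integrals.

(** * Limits of the sector integral *)

Section WedgeCvg.
Context {R : realType}.
Local Notation mu := (@lebesgue_measure R).
Variables (F w : R -> R).
Hypothesis Fnd : {homo F : x y / x <= y}.
Hypothesis F_le0 : forall x, x <= 0 -> F x = 0.
Hypothesis F_lt1 : forall x, F x < 1.
Hypothesis tail_cvg0 : 1 - F u @[u --> +oo] --> 0.
Hypothesis FG : gumbel_mda F w.

Definition wedge_integral (h a1 a2 : R) : R :=
  fine (\int[mu]_t (wedge F h a1 a2 t)%:E)%E.

Lemma wedge_ge0 h a1 a2 t : 0 <= wedge F h a1 a2 t.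
Proof. by rewrite /wedge; case: ifP => // _; rewrite subr_ge0 ltW. Qed.

Lemma cvg_sin_div_seq (c : R) (lam : R^nat) : lam n @[n --> \oo] --> 0 ->
  (\forall n \near \oo, 0 < lam n) ->
  sin (c * lam n) / lam n @[n --> \oo] --> c.
Proof.
move=> lam0 lamp.
have lam0' : lam n @[n --> \oo] --> 0^'.
  move=> A /= /lam0 hA; apply: filterS2 lamp hA => n l0; apply.
  by rewrite gt_eqF.
exact: (cvg_comp _ _ lam0' (@cvg_sin_div R c)).
Qed.

Lemma wedge_integral_rescale (h a1 a2 lam q I : R) : 0 < lam -> 0 < q ->
  (\int[mu]_v (wedge F h a1 a2 (lam * v) / q)%:E = I%:E)%E ->
  wedge_integral h a1 a2 = lam * q * I.
Proof.
move=> l0 q0 hI.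
have mW : measurable_fun [set: R] (wedge F h a1 a2) by exact: measurable_wedge.
rewrite /wedge_integral (@ge0_integral_affine _ _ lam 0)//; last 2 first.
- exact/measurable_EFinP.
- by move=> x; rewrite lee_fin wedge_ge0.
rewrite (_ : (fun x => _) = (fun x => q%:E * (wedge F h a1 a2 (lam * x) / q)%:E)%E); last first.
  by apply/funext => x; rewrite -EFinM addr0 (mulrC q) divfK ?gt_eqF.
rewrite ge0_integralZl_EFin ?ltW//=; last 2 first.
- by move=> x _; rewrite lee_fin divr_ge0 ?wedge_ge0 ?ltW.
- apply/measurable_EFinP; apply: measurable_funM => //.
  by apply: (measurableT_comp mW); exact: measurable_funM.
by rewrite hI -!EFinM /= mulrA.
Qed.

Lemma wedge_cvg_seq (h J : R) (b s r lam : R^nat) :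
  (\forall n \near \oo, 0 < lam n) ->
  (\int[mu]_v (wedge F h ((b n + s n / w (b n)) * cos h) ((b n + r n / w (b n)) * cos h)
      (lam n * v) / (1 - F (b n)))%:E
   @[n --> \oo] --> J%:E)%E ->
  wedge_integral h ((b n + s n / w (b n)) * cos h) ((b n + r n / w (b n)) * cos h)
    / (lam n * (1 - F (b n))) @[n --> \oo] --> J.
Proof.
move=> lamp /fine_cvgP[fn fc].
apply: cvg_trans fc; apply: near_eq_cvg; near=> n.
have l0 : 0 < lam n by near: n.
have q0 : 0 < 1 - F (b n) by rewrite subr_gt0.
have /fineK/esym/(wedge_integral_rescale l0 q0) -> :
  (\int[mu]_v (wedge F h ((b n + s n / w (b n)) * cos h)
  ((b n + r n / w (b n)) * cos h) (lam n * v) / (1 - F (b n)))%:E)%E \is a fin_num by near: n.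
by rewrite mulrC mulKf// gt_eqF// mulr_gt0.
Unshelve. all: by end_near. Qed.

(** For h > 0 the cosines vary to first order at the bisector, so the angular scale is 1 / B; the
    contribution of 1 - cos is of second order and disappears in the limit. *)
Lemma wedge_integral_cvg (h sl rl : R) (b s r : R -> R) : 0 < h < pi / 2 ->
  b u @[u --> +oo] --> +oo -> s u @[u --> +oo] --> sl -> r u @[u --> +oo] --> rl ->
  wedge_integral h ((b u + s u / w (b u)) * cos h) ((b u + r u / w (b u)) * cos h)
    / ((b u * w (b u))^-1 * (1 - F (b u))) @[u --> +oo] -->
  2 / tan h * expR (- ((sl + rl) / 2)).
Proof.
move=> /andP[h0 hpi] boo ssl rrl; apply/cvg_pinftyP => x xoo.
have pi0 := pi_gt0 R.
have ch : 0 < cos h by apply: cos_gt0_pihalf; apply/andP; split; lra.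
have th : 0 < tan h.
  by apply: divr_gt0 => //; apply: sin_gt0_pi; apply/andP; split; lra.
have bxoo := cvg_comp _ _ xoo boo.
have Boo : b (x n) * w (b (x n)) @[n --> \oo] --> +oo.
  exact: (cvg_comp _ _ bxoo (gumbel_mulw_cvgy F_le0 F_lt1 tail_cvg0 FG)).
have Bpos : \forall n \near \oo, 0 < b (x n) * w (b (x n)) := Boo _ (nbhs_pinfty_gt (num_real 0)).
pose lam n := (b (x n) * w (b (x n)))^-1.
have lampos : \forall n \near \oo, 0 < lam n.
  by apply: filterS Bpos => n; rewrite invr_gt0.
have lam0 : lam n @[n --> \oo] --> 0.
  exact: ((gtr0_cvgV0 Bpos).2 Boo).
apply: (@wedge_cvg_seq h _ (b \o x) (s \o x) (r \o x) lam) => //.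
rewrite -integral_expRN_max//.
(* The slope comes from sin x >= x / 2 on [0, pi / 2], the term 1 - cos x >= 0 being dropped. *)
have c0 : 0 < tan h / 2 by rewrite divr_gt0.
apply: (wedge_laplace Fnd F_le0 F_lt1 tail_cvg0 FG (b := b \o x) (s := s \o x) (r := r \o x)
   (c := tan h / 2) (M0 := 0) (L := fun v => tan h * v) _ c0) => //.
- by rewrite ltW.
- exact: (cvg_comp _ _ xoo ssl).
- exact: (cvg_comp _ _ xoo rrl).
- exact: measurable_funM.
- move=> v.
  have s1 := @cvg_sin_div_seq (v / 2) lam lam0 lampos.
  have s2 := @cvg_sin_div_seq v lam lam0 lampos.
  have s3 : sin (v / 2 * lam n) @[n --> \oo] --> (0 : R).
    rewrite -[X in _ --> X]sin0.
    have : v / 2 * lam n @[n --> \oo] --> 0.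
      by rewrite -[X in _ --> X](mulr0 (v / 2)); apply: cvgM => //; exact: cvg_cst.
    by move=> h1; exact: (cvg_comp _ _ h1 (@continuous_sin R 0)).
  have : 2 * (sin (v / 2 * lam n) / lam n * sin (v / 2 * lam n)) + tan h * (sin (v * lam n) / lam n)
     @[n --> \oo] --> 2 * (v / 2 * 0) + tan h * v.
    apply: cvgD; apply: cvgM => //; try exact: cvg_cst.
    exact: cvgM.
  rewrite !mulr0 add0r; apply: cvg_trans; apply: near_eq_cvg; near=> n.
  have B0 : 0 < b (x n) * w (b (x n)) by near: n.
  have -> : 1 - (cos (lam n * v) - tan h * sin (lam n * v)) =
     (1 - cos (lam n * v)) + tan h * sin (lam n * v) by ring.
  rewrite onem_cosE (mulrC (lam n) v) (mulrAC v) /lam/= invrK; ring.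
- near=> n => v v0 lv.
  have B0 : 0 < b (x n) * w (b (x n)) by near: n.
  have l0 : 0 < lam n by rewrite invr_gt0.
  have lv0 : 0 <= lam n * v by rewrite mulr_ge0// ltW.
  have h1 : lam n * v / 2 <= sin (lam n * v) by apply: sin_ge_half; rewrite lv0.
  have := cos_le1 (lam n * v) => h2.
  rewrite subr0 -ler_pdivrMl//=.
  have -> : (b (x n) * w (b (x n)))^-1 * (tan h / 2 * v) = tan h * (lam n * v / 2).
    by rewrite /lam; ring.
  have := ler_wpM2l (ltW th) h1; lra.
Unshelve. all: by end_near. Qed.

(** For h = 0 the first-order term vanishes and the cosine is quadratic at its maximum: the angular
    scale becomes 1 / sqrt B and the limit Gaussian. *)
Lemma wedge0_integral_cvg (sl : R) (b s : R -> R) :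
  b u @[u --> +oo] --> +oo -> s u @[u --> +oo] --> sl ->
  wedge_integral 0 (b u + s u / w (b u)) (b u + s u / w (b u))
    / ((Num.sqrt (b u * w (b u)))^-1 * (1 - F (b u))) @[u --> +oo] -->
  expR (- sl) * (Num.sqrt 2 * Num.sqrt pi).
Proof.
move=> boo ssl.
suff : wedge_integral 0 ((b u + s u / w (b u)) * cos 0) ((b u + s u / w (b u)) * cos 0)
    / ((Num.sqrt (b u * w (b u)))^-1 * (1 - F (b u))) @[u --> +oo] -->
    expR (- sl) * (Num.sqrt 2 * Num.sqrt pi).
  by apply: cvg_trans; apply: near_eq_cvg; apply: nearW => u; rewrite cos0 mulr1.
apply/cvg_pinftyP => x xoo.
have pi0 := pi_gt0 R.
have bxoo := cvg_comp _ _ xoo boo.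
have Boo : b (x n) * w (b (x n)) @[n --> \oo] --> +oo.
  exact: (cvg_comp _ _ bxoo (gumbel_mulw_cvgy F_le0 F_lt1 tail_cvg0 FG)).
have Bpos : \forall n \near \oo, 0 < b (x n) * w (b (x n)) := Boo _ (nbhs_pinfty_gt (num_real 0)).
pose lam n := (Num.sqrt (b (x n) * w (b (x n))))^-1.
have lampos : \forall n \near \oo, 0 < lam n.
  by apply: filterS Bpos => n; rewrite invr_gt0 sqrtr_gt0.
have lam0 : lam n @[n --> \oo] --> 0.
  have spos : \forall n \near \oo, 0 < Num.sqrt (b (x n) * w (b (x n))).
    by apply: filterS Bpos => n; rewrite sqrtr_gt0.
  apply/((gtr0_cvgV0 spos).2)/cvgryPge => K; near=> n.
  have B0 : 0 < b (x n) * w (b (x n)) by near: n.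
  apply: (le_trans (ler_norm K)); rewrite -sqrtr_sqr ler_wsqrtr//.
  by near: n; exact: (Boo _ (nbhs_pinfty_ge (num_real _))).
apply: (@wedge_cvg_seq 0 _ (b \o x) (s \o x) (s \o x) lam) => //.
rewrite -integral_expRN_sqr.
have -> : (fun v => (expR (- (sl + v ^+ 2 / 2)))%:E) =
   (fun v => (expR (- Num.max (sl + v ^+ 2 / 2) (sl + (- v) ^+ 2 / 2)))%:E).
  by apply/funext => v; rewrite sqrrN maxxx.
apply: (wedge_laplace Fnd F_le0 F_lt1 tail_cvg0 FG (b := b \o x) (s := s \o x) (r := s \o x)
   (c := 1) (M0 := 2) (L := fun v => v ^+ 2 / 2)) => //.
- by rewrite lexx divr_gt0.
- exact: (cvg_comp _ _ xoo ssl).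
- exact: (cvg_comp _ _ xoo ssl).
- by apply: measurable_funM => //; exact: measurable_funX.
- move=> v.
  have s1 := @cvg_sin_div_seq (v / 2) lam lam0 lampos.
  have : 2 * (sin (v / 2 * lam n) / lam n * (sin (v / 2 * lam n) / lam n))
     @[n --> \oo] --> 2 * (v / 2 * (v / 2)).
    by apply: cvgM; [exact: cvg_cst|exact: cvgM].
  rewrite (_ : 2 * (v / 2 * (v / 2)) = v ^+ 2 / 2); last by field.
  apply: cvg_trans; apply: near_eq_cvg; near=> n.
  have B0 : 0 < b (x n) * w (b (x n)) by near: n.
  rewrite tan0 mul0r subr0 onem_cosE (mulrC (lam n) v) (mulrAC v) /=.
  have -> : b (x n) * w (b (x n)) = (lam n)^-1 ^+ 2 by rewrite invrK sqr_sqrtr// ltW.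
  ring.
- near=> n => v v0 lv.
  have B0 : 0 < b (x n) * w (b (x n)) by near: n.
  have l0 : 0 < lam n by near: n.
  have lv0 : 0 <= lam n * v by rewrite mulr_ge0// ltW.
  have h1 : (lam n * v) ^+ 2 / 8 <= 1 - cos (lam n * v) by apply: onem_cos_ge; rewrite lv0.
  have := ler_wpM2l (ltW B0) h1; rewrite tan0 mul0r subr0 /=.
  have -> : b (x n) * w (b (x n)) * ((lam n * v) ^+ 2 / 8) = v ^+ 2 / 8.
    have -> : b (x n) * w (b (x n)) = (lam n)^-1 ^+ 2 by rewrite invrK sqr_sqrtr// ltW.
    by field; rewrite gt_eqF.
  (* A linear lower bound is required: v^2 / 8 >= v - 2 amounts to (v - 4)^2 >= 0, whence [c = 1]
     and [M0 = 2]. *)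
  have := sqr_ge0 (v - 4); lra.
Unshelve. all: by end_near. Qed.

End WedgeCvg.

(** * Polar representation *)

Section Polar.
Context {R : realType} {d : measure_display} {T : measurableType d}.
Variables (P : probability T R) (rad U1 U2 : {RV P >-> R}).
Local Notation mu := (@lebesgue_measure R).
Hypothesis indep : independent_of P rad (fun t => (U1 t, U2 t)).
Hypothesis unif : uniform_on_unit_circle U1 U2.

Let mU : measurable_fun [set: T] (fun t => (U1 t, U2 t)).
Proof. exact: measurable_fun_pair. Qed.
Let mU_mixin := isMeasurableFun.Build _ _ _ _ _ mU.
Let U : {mfun T >-> (R * R)%type} := HB.pack (fun t => (U1 t, U2 t)) mU_mixin.

Let mV : measurable_fun [set: T] (fun t => (rad t, (U1 t, U2 t))).
Proof. exact: measurable_fun_pair. Qed.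
Let mV_mixin := isMeasurableFun.Build _ _ _ _ _ mV.
Let V : {mfun T >-> (R * (R * R))%type} := HB.pack (fun t => (rad t, (U1 t, U2 t))) mV_mixin.

Let angle (a : R) : R * R := (cos a, sin a).
Let mangle : measurable_fun [set: R] angle.
Proof.
by apply: measurable_fun_pair; apply: continuous_measurable_fun;
  [exact: continuous_cos|exact: continuous_sin].
Qed.

Let m1 := distribution P rad.
Let m2 := distribution P U.

Let polar_productE (A : set (R * (R * R))) : measurable A ->
  P [set t | A (rad t, (U1 t, U2 t))] = (m1 \x m2)%E A.
Proof.
move=> mA; apply/esym; have -> : P [set t | A (rad t, (U1 t, U2 t))] = distribution P V A by [].
by apply: product_measure_unique => // B C mB mC; exact: indep.
Qed.

Lemma polar_probE (A : set (R * (R * R))) : measurable A ->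
  P [set t | A (rad t, (U1 t, U2 t))] =
  ((2 * pi)^-1%:E * \int[mu]_(a in `[0%R, (2 * pi)%R])
     distribution P rad [set x | A (x, (cos a, sin a))])%E.
Proof.
move=> mA; rewrite polar_productE//.
have -> : (m1 \x m2)%E A = (m1 \x^ m2)%E A.
  by apply: product_measure_unique => // B C mB mC; exact: product_measure2E.
rewrite /product_measure2/=.
have mf : measurable_fun [set: R * R] (m1 \o ysection A).
  exact: measurable_fun_ysection.
rewrite (eq_measure_integral (pushforward (uniform_prob (twopi_gt0 R)) angle)); last first.
  by move=> B mB _; exact: unif.
rewrite ge0_integral_pushforward//.
rewrite preimage_setT integral_uniform//=; last first.
  exact: (measurableT_comp mf mangle).
rewrite subr0; congr (_ * _)%E; apply: eq_integral => a _.
rewrite /m1; congr (distribution P rad _).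
by apply/seteqP; split => x /=; rewrite /ysection/= inE.
Qed.

Lemma uniform_probE (a b : R) (ab : a < b) (A : set R) : measurable A ->
  uniform_prob ab A = ((b - a)^-1%:E * mu (A `&` `[a, b]))%E.
Proof.
move=> mA; rewrite -[in LHS](setIT A) -integral_indic// integral_uniform//=; last first.
  by apply/measurable_EFinP; exact: measurable_indic.
by rewrite integral_indic.
Qed.

Let angle_probE (B : set R) : measurable B ->
  uniform_prob (twopi_gt0 R) B = ((2 * pi)^-1%:E * mu (B `&` `[0%R, (2 * pi)%R]))%E.
Proof. by move=> mB; rewrite uniform_probE// subr0. Qed.

Let mslice (A : set (R * (R * R))) x : measurable A ->
  measurable [set a : R | A (x, (cos a, sin a))].
Proof.
move=> mA; rewrite -[X in measurable X]setTI.
have -> : [set a : R | A (x, (cos a, sin a))] = angle @^-1` (xsection A x).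
  by apply/seteqP; split => a /=; rewrite /xsection/= inE.
by apply: mangle => //; exact: measurable_xsection.
Qed.

(** The other order of Fubini: slices at fixed radius are sets of angles, measured by Lebesgue
    measure, so null and non-null events are recognized without regularity of [F]. *)
Lemma polar_radialE (A : set (R * (R * R))) : measurable A ->
  P [set t | A (rad t, (U1 t, U2 t))] =
  (\int[distribution P rad]_x
    ((2 * pi)^-1%:E * mu ([set a : R | A (x, (cos a, sin a))] `&` `[0%R, (2 * pi)%R])))%E.
Proof.
move=> mA; rewrite polar_productE// /product_measure1/=.
apply: eq_integral => x _.
rewrite -angle_probE; last exact: mslice.
apply: etrans (unif (measurable_xsection x mA)) _.
by congr (uniform_prob _ _); apply/seteqP; split => a /=; rewrite /xsection/= inE.
Qed.

Lemma measurable_radial_slice (A : set (R * (R * R))) : measurable A ->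
  measurable_fun [set: R] (fun x => ((2 * pi)^-1%:E *
    mu ([set a : R | A (x, (cos a, sin a))] `&` `[0%R, (2 * pi)%R]))%E).
Proof.
move=> mA.
apply: eq_measurable_fun (measurable_fun_xsection m2 mA) => x _ /=.
rewrite -angle_probE; last exact: mslice.
apply: etrans (unif (measurable_xsection x mA)) _.
by congr (uniform_prob _ _); apply/seteqP; split => a /=; rewrite /xsection/= inE.
Qed.

Let F := rcdf rad.
Hypothesis F0 : F 0 = 0.

Let cdfE x : cdf rad x = (F x)%:E.
Proof. by rewrite /F /rcdf fineK// fin_num_measure. Qed.

Lemma distribution_sector (a1 a2 c1 c2 : R) : 0 < a1 -> 0 < a2 ->
  distribution P rad [set x | a1 < x * c1 /\ a2 < x * c2] =
  (if (0 < c1) && (0 < c2) then 1 - F (Num.max (a1 / c1) (a2 / c2)) else 0)%:E.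
Proof.
move=> a10 a20; case: ifPn => [/andP[c10 c20]|].
  rewrite (_ : [set x | _] = `]Num.max (a1 / c1) (a2 / c2), +oo[%classic); last first.
    apply/seteqP; split=> x /=; rewrite in_itv/= andbT gt_max !ltr_pdivrMr//.
      by move=> [-> ->].
    by move=> /andP[].
  by rewrite -/(ccdf rad _) ccdf_1_cdf cdfE -EFinB.
(* If one coefficient is not positive, the inequalities force the radius to be nonpositive, an event
   of probability [F 0 = 0]. *)
move=> c12; apply/eqP; rewrite eq_le measure_ge0 andbT.
rewrite -F0 -cdfE /cdf; apply: le_measure; rewrite ?inE//.
  apply: measurableI; rewrite -[X in measurable X]setTI.
    by apply: measurable_fun_ltr => //; exact: measurable_funM.
  by apply: measurable_fun_ltr => //; exact: measurable_funM.
move=> x /= [h1 h2]; rewrite in_itv/= leNgt; apply/negP => x0.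
move: c12; rewrite -(pmulr_rgt0 c1 x0) -(pmulr_rgt0 c2 x0).
by rewrite (lt_trans a10 h1) (lt_trans a20 h2).
Qed.

Lemma measurable_sector (a1 a2 p q : R) :
  measurable [set v : R * (R * R) | a1 < v.1 * v.2.1 /\ a2 < v.1 * (p * v.2.1 + q * v.2.2)].
Proof.
have mf2 : measurable_fun [set: R * (R * R)] (fun v => v.2.1).
  exact: (measurableT_comp measurable_fst measurable_snd).
have mf3 : measurable_fun [set: R * (R * R)] (fun v => v.2.2).
  exact: (measurableT_comp measurable_snd measurable_snd).
have mf1 : measurable_fun [set: R * (R * R)] (fun v => v.1) by exact: measurable_fst.
apply: measurableI; rewrite -[X in measurable X]setTI.
  by apply: measurable_fun_ltr => //; exact: measurable_funM.
apply: measurable_fun_ltr => //; apply: measurable_funM => //.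
by apply: measurable_funD; exact: measurable_funM.
Qed.

(** Periodicity moves the angles to an interval of length 2 pi centred at phi / 2, and a translation
    by phi / 2 puts the bisector at 0. The case phi = 0 is allowed: it gives the marginal tail. *)
Lemma polar_sector_prob (phi a1 a2 : R) : 0 <= phi <= pi -> 0 < a1 -> 0 < a2 ->
  P [set t | a1 < rad t * U1 t /\ a2 < rad t * (cos phi * U1 t + sin phi * U2 t)] =
  ((2 * pi)^-1%:E * \int[mu]_t (wedge F (phi / 2) a1 a2 t)%:E)%E.
Proof.
move=> /andP[phi0 phipi] a10 a20; have pi0 := pi_gt0 R.
pose A := [set v : R * (R * R) | a1 < v.1 * v.2.1 /\
  a2 < v.1 * (cos phi * v.2.1 + sin phi * v.2.2)].
rewrite (@polar_probE A); last exact: measurable_sector.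
congr (_ * _)%E.
pose G a := distribution P rad [set x | A (x, (cos a, sin a))].
have GE a : G a = (if (0 < cos a) && (0 < cos (a - phi)) then
    1 - F (Num.max (a1 / cos a) (a2 / cos (a - phi))) else 0)%:E.
  by rewrite -distribution_sector// /G /A/= cosB mulrC (mulrC (sin a)).
have mG : measurable_fun [set: R] G.
  have mf : measurable_fun [set: R * R] (distribution P rad \o ysection A).
    by apply: measurable_fun_ysection; exact: measurable_sector.
  apply: eq_measurable_fun (measurableT_comp mf mangle) => a _ /=.
  congr (distribution P rad _).
  by apply/seteqP; split => x /=; rewrite /ysection/= inE.
have G0 a : (0 <= G a)%E by exact: measure_ge0.
have Gper a : G (a + 2 * pi) = G a.
  by rewrite !GE addrAC mulr2n -mulr2n mulr_natl !cosD2pi.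
rewrite (@ge0_integral_periodic _ _ _ (phi / 2 + pi))//; last first.
  by apply/andP; split; lra.
rewrite integral_mkcond [LHS](@ge0_integral_affine _ _ 1 (phi / 2))//; last 2 first.
- apply: (measurable_restrictT _ _).1 => //; exact: measurable_funTS.
- by move=> x; apply: erestrict_ge0.
rewrite mul1e; apply: eq_integral => t _.
rewrite patchE mem_setE in_itv/= mul1r /wedge -/(G _) GE.
rewrite (_ : t + phi / 2 - phi = t - phi / 2); last by field.
rewrite (_ : (_ <= t + phi / 2) = (- pi <= t)); last by apply/idP/idP => ?; lra.
rewrite (_ : (t + phi / 2 <= _) = (t <= pi)); last by apply/idP/idP => ?; lra.
by case: (- pi <= t); case: (t <= pi).
Qed.

(** For each radius x, x cos b = a has at most two solutions in [0, 2 pi], so every slice is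
    null. *)
Lemma polar_abscissa_atomless (a : R) : 0 < a -> P [set t | rad t * U1 t = a] = 0%E.
Proof.
move=> a0; have pi0 := pi_gt0 R.
have mA : measurable [set v : R * (R * R) | v.1 * v.2.1 = a].
  have m : measurable_fun [set: R * (R * R)] (fun v => v.1 * v.2.1).
    apply: measurable_funM; first exact: measurable_fst.
    exact: (measurableT_comp measurable_fst measurable_snd).
  by have := m measurableT _ (measurable_set1 a); rewrite setTI.
rewrite (polar_radialE mA) integral0_eq// => x _ /=.
suff -> : mu ([set b | x * cos b = a] `&` `[0%R, (2 * pi)%R]) = 0%E by rewrite mule0.
pose c := acos (a / x).
have c0 : mu ([set c] `|` [set 2 * pi - c]) = 0%E.
  apply: null_set_setU => //; exact: lebesgue_measure_set1.
apply/eqP; rewrite -measure_le0 -c0; apply: le_measure; rewrite ?inE.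
- have := mslice x mA => /= mb; exact: measurableI.
- exact: measurableU.
- move=> b /= [xb]; rewrite in_itv/= => /andP[b0 b2].
  have x0 : x != 0 by apply: contra_eq_neq xb => /= ->; rewrite mul0r lt_eqF.
  have cb : a / x = cos b by rewrite -xb mulrC mulKf.
  have [bpi|bpi] := leP b pi.
    by left; rewrite /c cb cosK// in_itv/= b0.
  right; rewrite /c cb (_ : cos b = cos (2 * pi - b)).
    by rewrite cosK ?in_itv/=; [lra|apply/andP; split; lra].
  by rewrite -[RHS]cosN opprB -[in LHS](subrK (2 * pi) b) mulr_natl cosD2pi.
Qed.

(** Every radius r > y admits the whole interval of angles between acos (y / r) and acos (x / r),
    and such radii have probability 1 - F y > 0. *)
Lemma polar_abscissa_itv_gt0 (x y : R) : (forall r, F r < 1) -> 0 < x -> x < y ->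
  (0 < P [set t | (x < rad t * U1 t <= y)%R])%E.
Proof.
move=> F1 x0 xy; have pi0 := pi_gt0 R.
have y0 := lt_trans x0 xy.
have mA : measurable [set v : R * (R * R) | x < v.1 * v.2.1 <= y].
  have m : measurable_fun [set: R * (R * R)] (fun v => v.1 * v.2.1).
    apply: measurable_funM; first exact: measurable_fst.
    exact: (measurableT_comp measurable_fst measurable_snd).
  have := m measurableT _ (measurable_itv `]x, y]); rewrite setTI.
  by congr measurable; apply/seteqP; split => v /=; rewrite in_itv.
rewrite lt_neqAle measure_ge0 andbT; apply/negP => /eqP/esym.
rewrite (polar_radialE mA) /=; set f := fun r : R => (_ * _)%E => fint.
have mf : measurable_fun [set: R] f by exact: measurable_radial_slice mA.
have f0 r : (0 <= f r)%E by rewrite mule_ge0// lee_fin invr_ge0 mulr_ge0// ltW.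
have fpos r : y < r -> (0 < f r)%E.
  move=> yr; have r0 := lt_trans y0 yr.
  rewrite mule_gt0 ?lte_fin ?invr_gt0 ?mulr_gt0//.
  have yr1 : -1 <= y / r <= 1.
    by rewrite ler_pdivrMr// mul1r (ltW yr) andbT (@le_trans _ _ 0)// ?lerN10// divr_ge0// ltW.
  have xr1 : -1 <= x / r <= 1.
    by rewrite ler_pdivrMr// mul1r (ltW (lt_trans xy yr)) andbT (@le_trans _ _ 0)// ?lerN10// divr_ge0// ltW.
  have acxy : acos (y / r) < acos (x / r).
    rewrite -ltr_cos ?acosK ?in_itv/= ?acos_ge0 ?acos_lepi//.
    by rewrite ltr_pM2r ?invr_gt0.
  apply: (@lt_le_trans _ _ (mu `]acos (y / r), acos (x / r)[)).
    by rewrite lebesgue_measure_itv/= lte_fin acxy -EFinB lte_fin subr_gt0.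
  apply: le_measure; rewrite ?inE//.
    by apply: measurableI => //; exact: (mslice r mA).
  move=> b /=; rewrite !in_itv/= => /andP[b1 b2].
  have b0 : 0 <= b by rewrite (le_trans _ (ltW b1))// acos_ge0.
  have bpi : b <= pi by rewrite (le_trans (ltW b2))// acos_lepi.
  split; last by rewrite b0/=; lra.
  rewrite mulrC -ltr_pdivrMr// -ler_pdivlMr//; apply/andP; split.
    by rewrite -[X in X < _]acosK ?in_itv/= ?xr1// ltr_cos// in_itv/= ?b0 ?acos_ge0 ?acos_lepi.
  by rewrite -[X in _ <= X]acosK ?in_itv/= ?yr1// leNgt ltr_cos -?leNgt ?(ltW b1)// in_itv/= ?b0 ?acos_ge0 ?acos_lepi.
have : {ae distribution P rad, forall r, [set: R] r -> f r = 0%E}.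
  apply/(ae_eq_integral_abs _ measurableT mf).
  by under eq_integral do rewrite gee0_abs//.
move=> [N [mN N0 fN]].
have : (distribution P rad `]y, +oo[ <= distribution P rad N)%E.
  apply: le_measure; rewrite ?inE// => r /=; rewrite in_itv/= andbT => yr.
  by apply: fN => /= /(_ I) fr; have := fpos _ yr; rewrite fr ltxx.
rewrite N0 -/(ccdf rad y) ccdf_1_cdf cdfE -EFinB lee_fin subr_le0.
by rewrite leNgt F1.
Qed.
End Polar.

(** * Quantiles *)

Section Quantile.
Context {R : realType} {d : measure_display} {T : measurableType d}.
Variables (P : probability T R) (X : {RV P >-> R}).
Let Q := rcdf X.

Lemma rcdfE x : cdf X x = (Q x)%:E.
Proof. by rewrite /Q /rcdf fineK// fin_num_measure. Qed.

Lemma rcdf_nondecreasing : {homo Q : x y / x <= y}.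
Proof. by move=> x y xy; rewrite -lee_fin -!rcdfE cdf_nondecreasing. Qed.

Lemma rcdf_le1 x : Q x <= 1.
Proof. by rewrite -lee_fin -rcdfE cdf_le1. Qed.

Lemma rcdf_ge0 x : 0 <= Q x.
Proof. by rewrite -lee_fin -rcdfE cdf_ge0. Qed.

Lemma rcdf_cvg1 : 1 - Q u @[u --> +oo] --> 0.
Proof.
have /fine_cvgP[_] := cvg_ccdfy0 X.
apply: cvg_trans; apply: near_eq_cvg; apply: nearW => u /=.
by rewrite ccdf_1_cdf rcdfE.
Qed.

Hypothesis atomless : forall a, 0 < a -> P [set t | X t = a] = 0%E.
Hypothesis Q_inc : forall x y, 0 < x -> x < y -> Q x < Q y.

(** The point [a] keeps the infimum inside the positive half-line, where continuity and strict
    increase are known. Right continuity gives [p <= Q q]. *)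
Lemma cdf_inverse_spec (a p : R) : 0 < a -> Q a < p -> p < 1 ->
  let q := cdf_inverse Q p in
  [/\ a < q, Q q = p & forall t, (p < Q t) = (q < t)].
Proof.
move=> a0 Qap p1 q.
pose S := [set x | p <= Q x].
have lbS x : S x -> a <= x.
  move=> Sx; rewrite leNgt; apply/negP => xa.
  by have := lt_le_trans Qap (le_trans Sx (rcdf_nondecreasing (ltW xa))); rewrite ltxx.
have infS : has_inf S.
  split; last by exists a => x; exact: lbS.
  have p10 : 0 < 1 - p by lra.
  have [M [_ HM]] := cvgr_lt _ rcdf_cvg1 _ p10.
  exists (M + 1); have /= := HM (M + 1) ltac:(lra); rewrite /S/=; lra.
have aq : a <= q by apply: lb_le_inf; [exact: infS.1|move=> x; exact: lbS].
have q0 : 0 < q by exact: lt_le_trans aq.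
have Qlt t : t < q -> Q t < p.
  move=> tq; rewrite ltNge; apply/negP => Qt.
  by have := ge_inf infS.2 Qt; rewrite leNgt tq.
have pQ : p <= Q q.
  rewrite leNgt; apply/negP => Qqp.
  have := @cdf_right_continuous _ _ _ _ X q; rewrite rcdfE => /fine_cvgP[_ h].
  have h' : Q s @[s --> q^'+] --> Q q by exact: h.
  have := cvgr_lt _ h' _ Qqp.
  move=> [e /= e0 He].
  have [s Ss sq] := inf_adherent e0 infS.
  have qs : q <= s := ge_inf infS.2 Ss.
  have qs' : q < s.
    rewrite lt_neqAle qs andbT; apply/eqP => qse.
    by have := lt_le_trans Qqp Ss; rewrite qse ltxx.
  have : Q s < p.
    apply: He => //; rewrite /ball/= ltr0_norm; last by rewrite subr_lt0.
    by rewrite opprB ltrBlDr addrC.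
  by rewrite ltNge => /negP; apply.
(* X < q is the increasing union of the events X <= q - 1/(n+1), each of probability below [p], and
   q is not an atom. *)
have Qp : Q q <= p.
  pose G n := X @^-1` `]-oo, q - n.+1%:R^-1].
  have mG n : measurable (G n) by exact: measurable_funPTI.
  have UG : \bigcup_n G n = X @^-1` `]-oo, q[.
    apply/seteqP; split => t /=.
      move=> [n _]; rewrite /G/= !in_itv/= => h; apply: (le_lt_trans h).
      by rewrite ltrBlDr ltrDl.
    rewrite in_itv/= => tq.
    have qt0 : 0 < q - X t by rewrite subr_gt0.
    have [n _ Hn] := near_infty_natSinv_lt (PosNum qt0).
    exists n => //; rewrite /G/= in_itv/= lerBrDr addrC -lerBrDr ltW//.
    exact: (Hn n (leqnn n)).
  have mUG : measurable (\bigcup_n G n) by exact: bigcup_measurable.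
  have ndG : nondecreasing_seq G.
    move=> m n mn; apply/subsetPset => t; rewrite /G/= !in_itv/= => h; apply: (le_trans h).
    by rewrite lerD2l lerN2 lef_pV2 ?posrE// ler_nat.
  have Gle n : (P (G n) <= p%:E)%E.
    rewrite -[leLHS]/(cdf X (q - n.+1%:R^-1)) rcdfE lee_fin ltW// Qlt//.
    by rewrite ltrBlDr ltrDl.
  have cG : (P \o G) n @[n --> \oo] --> P (\bigcup_n G n) by exact: nondecreasing_cvg_mu.
  have : (P (\bigcup_n G n) <= p%:E)%E.
    rewrite -(cvg_lim _ cG)//; apply: lime_le; first by apply/cvg_ex; eexists; exact: cG.
    exact: nearW.
  rewrite UG => h.
  rewrite -lee_fin -rcdfE.
  have -> : cdf X q = (P (X @^-1` `]-oo, q[) + P [set t | X t = q])%E.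
    rewrite -measureU//.
    - congr (P _); apply/seteqP; split => t /=; rewrite !in_itv/=.
        by rewrite le_eqVlt => /orP[/eqP ->|->]; [right|left].
      by move=> [/ltW//|->].
    - exact: measurable_funPTI.
    - exact: (measurable_funPTI X (measurable_set1 q)).
    - by apply/seteqP; split => t //= []; rewrite in_itv/= => h1 h2; move: h1; rewrite h2 ltxx.
  by rewrite atomless// adde0.
have Qq : Q q = p by apply/eqP; rewrite eq_le Qp pQ.
split => //.
  by rewrite lt_neqAle aq andbT; apply/eqP => aqe; move: Qap; rewrite aqe Qq ltxx.
move=> t; apply/idP/idP => [pt|qt].
  rewrite ltNge; apply/negP => tq.
  by have := lt_le_trans pt (rcdf_nondecreasing tq); rewrite Qq ltxx.
by rewrite -Qq Q_inc.
Qed.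

End Quantile.

(** * Asymptotics of the joint tail *)

Section Asymptotics.
Context {R : realType}.
Variables (F w : R -> R).
Hypothesis Fnd : {homo F : x y / x <= y}.
Hypothesis F_le0 : forall x, x <= 0 -> F x = 0.
Hypothesis F_lt1 : forall x, F x < 1.
Hypothesis tail_cvg0 : 1 - F u @[u --> +oo] --> 0.
Hypothesis FG : gumbel_mda F w.
Variable h : R.
Hypothesis h_itv : 0 < h < pi / 2.
(** [J] stands for the joint exceedance probability, [H] for the marginal tail and [q x u] for the
    marginal quantile of level 1 - x / u. *)
Variables (J : R -> R -> R) (H : R -> R).
Hypothesis JE : forall x y, 0 < x -> 0 < y ->
  J x y = (2 * pi)^-1 * wedge_integral F h x y.
Hypothesis HE : forall x, 0 < x -> H x = (2 * pi)^-1 * wedge_integral F 0 x x.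
Hypothesis J_ni : forall x1 x2 y1 y2, x1 <= x2 -> y1 <= y2 -> J x2 y2 <= J x1 y1.
Hypothesis H_ni : forall x y, x <= y -> H y <= H x.
Hypothesis H_gt0 : forall x, 0 < H x.
Variable q : R -> R -> R.
Hypothesis q_cvgy : forall x, 0 < x -> q x u @[u --> +oo] --> +oo.
Hypothesis qH : forall x, 0 < x -> \forall u \near +oo, H (q x u) = x / u.

Let pi0 : 0 < pi :> R := pi_gt0 R.
Let ch0 : 0 < cos h.
Proof. by apply: cos_gt0_pihalf; move: h_itv pi0 => /andP[? ?] ?; apply/andP; split; lra. Qed.
Let th0 : 0 < tan h.
Proof.
by apply: divr_gt0 => //; apply: sin_gt0_pi; move: h_itv pi0 => /andP[? ?] ?;
  apply/andP; split; lra.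
Qed.

Let cst_cvg (z : R) : (fun _ : R => z) u @[u --> +oo] --> z.
Proof. exact: cvg_cst. Qed.

Let shift_gt0 (b s : R -> R) (l : R) : b u @[u --> +oo] --> +oo -> s u @[u --> +oo] --> l ->
  \forall u \near +oo, 0 < b u + s u / w (b u).
Proof.
move=> boo sl; near=> u.
have b0 : 0 < b u by near: u; exact: (boo _ (nbhs_pinfty_gt (num_real _))).
have w0 := FG.1 _ b0.
have Bs : `|l| + 1 < b u * w (b u).
  near: u; exact: (cvg_comp _ _ boo (gumbel_mulw_cvgy F_le0 F_lt1 tail_cvg0 FG)
    _ (nbhs_pinfty_gt (num_real _))).
have sS : `|s u| < `|l| + 1 by near: u; apply: (cvgr_lt _ (cvg_norm sl)); lra.
rewrite -(pmulr_lgt0 _ w0) mulrDl divfK ?gt_eqF//.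
by move: sS; rewrite ltr_norml => /andP[? _]; lra.
Unshelve. all: by end_near. Qed.

Lemma joint_cvg (b s r : R -> R) (sl rl : R) :
  b u @[u --> +oo] --> +oo -> s u @[u --> +oo] --> sl -> r u @[u --> +oo] --> rl ->
  J ((b u + s u / w (b u)) * cos h) ((b u + r u / w (b u)) * cos h)
    / ((b u * w (b u))^-1 * (1 - F (b u))) @[u --> +oo] -->
  (2 * pi)^-1 * (2 / tan h * expR (- ((sl + rl) / 2))).
Proof.
move=> boo ssl rrl.
have := wedge_integral_cvg Fnd F_le0 F_lt1 tail_cvg0 FG h_itv boo ssl rrl.
move=> /(cvgM (cvg_cst (2 * pi)^-1)); apply: cvg_trans; apply: near_eq_cvg.
near=> u; rewrite /= mulrA -JE// mulr_gt0//; near: u.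
  exact: (shift_gt0 boo ssl).
exact: (shift_gt0 boo rrl).
Unshelve. all: by end_near. Qed.

(** Shifted and unshifted tails are normalized by the same factor at [u], which cancels in the
    quotient of their Laplace limits. *)
Lemma marginal_gumbel (z : R) :
  H (u + z / w u) / H u @[u --> +oo] --> expR (- z).
Proof.
have idoo : (u : R) @[u --> +oo] --> +oo by exact: cvg_id.
have c1 := wedge0_integral_cvg Fnd F_le0 F_lt1 tail_cvg0 FG idoo (@cst_cvg z).
have c0 := wedge0_integral_cvg Fnd F_le0 F_lt1 tail_cvg0 FG idoo (@cst_cvg 0).
have C0 : 0 < Num.sqrt 2 * Num.sqrt pi :> R by rewrite mulr_gt0// sqrtr_gt0.
have l0 : expR (- 0) * (Num.sqrt 2 * Num.sqrt pi) != 0 :> R.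
  by rewrite gt_eqF// mulr_gt0// expR_gt0.
have <- : expR (- z) * (Num.sqrt 2 * Num.sqrt pi) / (expR (- 0) * (Num.sqrt 2 * Num.sqrt pi))
    = expR (- z).
  by rewrite oppr0 expR0 mul1r mulfK// gt_eqF.
apply: (cvg_trans _ (cvgM c1 (cvgV l0 c0))); apply: near_eq_cvg; near=> u.
have u0 : 0 < u by near: u; exact: (nbhs_pinfty_gt (num_real _)).
have wu := FG.1 _ u0.
have uz : 0 < u + z / w u by near: u; exact: (shift_gt0 idoo (@cst_cvg z)).
have D0 : (Num.sqrt (u * w u))^-1 * (1 - F u) != 0.
  by rewrite gt_eqF// mulr_gt0 ?subr_gt0// invr_gt0 sqrtr_gt0 mulr_gt0.
rewrite /= mul0r addr0 !HE//.
have := H_gt0 u; rewrite HE// pmulr_rgt0 ?invr_gt0 ?mulr_gt0//.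
move: (wedge_integral F 0 u u) (wedge_integral F 0 _ _) => W W1 W0.
move: (_ * (1 - F u)) D0 => D D0.
rewrite -[LHS]mulf_div -[RHS]mulf_div !divff ?mul1r ?mulr1 ?invr_eq0//.
by rewrite gt_eqF// mulr_gt0.
Unshelve. all: by end_near. Qed.

(** The Laplace limit is positive, so [J] is positive far out on the diagonal, and monotonicity
    brings this back to every point. *)
Lemma joint_pos (x y : R) : 0 < J x y.
Proof.
have idoo : (u : R) @[u --> +oo] --> +oo by exact: cvg_id.
have lim := joint_cvg idoo (@cst_cvg 0) (@cst_cvg 0).
have l0 : 0 < (2 * pi)^-1 * (2 / tan h * expR (- ((0 + 0) / 2))).
  by rewrite mulr_gt0 ?invr_gt0 ?mulr_gt0// ?expR_gt0// invr_gt0.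
have [M [_ HM]] := cvgr_gt _ lim _ l0.
have [u [uM u0 ux uy]] : exists u, [/\ M < u, 0 < u, x <= u * cos h & y <= u * cos h].
  exists (`|M| + 1 + (`|x| + `|y|) / cos h).
  have xy0 : 0 <= (`|x| + `|y|) / cos h by apply: divr_ge0; [exact: addr_ge0|exact: ltW].
  have := ler_norm M; have := ler_norm x; have := ler_norm y.
  have c1 : 0 <= (`|M| + 1) * cos h by rewrite mulr_ge0 ?addr_ge0// ltW.
  have := normr_ge0 x; have := normr_ge0 y; have := normr_ge0 M.
  by split; rewrite ?(mulrDl (`|M| + 1)) ?divfK ?gt_eqF//; lra.
have /= := HM u uM; rewrite mul0r addr0 => Ju.
have n0 : 0 < (u * w u)^-1 * (1 - F u).
  by rewrite mulr_gt0 ?subr_gt0// invr_gt0 mulr_gt0// FG.1.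
move: Ju; rewrite pmulr_lgt0 ?invr_gt0// => /lt_le_trans; apply; exact: J_ni.
Qed.

(** [H (q x u)] is [x] times [H (q 1 u)], hence lies strictly between the values of [H] at shifts
    [- ln x + e] and [- ln x - e]; as [H] is nonincreasing, this orders the arguments. *)
Lemma quantile_shift (x : R) : 0 < x ->
  w (q 1 u) * (q x u - q 1 u) @[u --> +oo] --> - ln x.
Proof.
move=> x0; have q1oo := q_cvgy ltr01.
apply/cvgrPdist_lt => e e0.
have ce (z : R) := cvg_comp _ _ q1oo (@marginal_gumbel z).
have lim1 : expR (- (- ln x + e)) < x.
  by rewrite opprD opprK expRD lnK ?posrE// gtr_pMr// expR_lt1; lra.
have lim2 : x < expR (- (- ln x - e)).
  by rewrite opprB expRD opprK lnK ?posrE// mulrC ltr_pMr// expR_gt1.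
near=> u.
have u0 : 0 < u by near: u; exact: (nbhs_pinfty_gt (num_real _)).
have q0 : 0 < q 1 u by near: u; exact: (q1oo _ (nbhs_pinfty_gt (num_real _))).
have wq := FG.1 _ q0.
have H1 : H (q 1 u) = 1 / u by near: u; exact: qH.
have Hx : H (q x u) = x / u by near: u; exact: qH.
have xE : x * H (q 1 u) = H (q x u) by rewrite H1 Hx mulrA mulr1.
have h1 : H (q 1 u + (- ln x + e) / w (q 1 u)) / H (q 1 u) < x.
  by near: u; exact: (cvgr_lt _ (ce _) _ lim1).
have h2 : x < H (q 1 u + (- ln x - e) / w (q 1 u)) / H (q 1 u).
  by near: u; exact: (cvgr_gt _ (ce _) _ lim2).
move: h1 h2; rewrite ltr_pdivrMr// ltr_pdivlMr// xE => h1 h2.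
have k1 : q x u < q 1 u + (- ln x + e) / w (q 1 u).
  by rewrite ltNge; apply/negP => /H_ni; rewrite leNgt h1.
have k2 : q 1 u + (- ln x - e) / w (q 1 u) < q x u.
  by rewrite ltNge; apply/negP => /H_ni; rewrite leNgt h2.
move: k1; rewrite -ltrBlDl ltr_pdivlMr// => k1.
move: k2; rewrite -ltrBrDl ltr_pdivrMr// => k2.
by rewrite ltr_norml mulrC; apply/andP; split; lra.
Unshelve. all: by end_near. Qed.

Let div_2pi_tan (p t : R) : 0 < p -> 0 < t -> (2 * p)^-1 * (2 / t) = (p * t)^-1.
Proof. by move=> p0 t0; field; rewrite !gt_eqF. Qed.

Let a := (cos h)^-1.
Let b u := a * q 1 u.
Let S x y u := J (q x u) (q y u).

Let a0 : 0 < a. Proof. by rewrite invr_gt0. Qed.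

Let b_cvgy : b u @[u --> +oo] --> +oo.
Proof. exact: gt0_cvgMry a0 (q_cvgy ltr01). Qed.

Let bcos u : b u * cos h = q 1 u.
Proof. by rewrite /b /a mulrC mulrA divff ?mul1r// gt_eqF. Qed.

Let norm u := (b u * w (b u))^-1 * (1 - F (b u)).

Let norm_gt0 : \forall u \near +oo, 0 < norm u.
Proof.
near=> u; have b0 : 0 < b u by near: u; exact: (@b_cvgy _ (nbhs_pinfty_gt (num_real _))).
by rewrite mulr_gt0 ?subr_gt0// invr_gt0 mulr_gt0// FG.1.
Unshelve. all: by end_near. Qed.

Lemma joint_diag_cvg : S 1 1 u / norm u @[u --> +oo] --> (pi * tan h)^-1.
Proof.
have := joint_cvg b_cvgy (@cst_cvg 0) (@cst_cvg 0).
rewrite addr0 mul0r oppr0 expR0 mulr1.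
have -> : (2 * pi)^-1 * (2 / tan h) = (pi * tan h)^-1 by exact: div_2pi_tan.
apply: cvg_trans; apply: near_eq_cvg; apply: nearW => u.
by rewrite mul0r addr0 bcos.
Qed.

Lemma joint_shift_ratio (s r : R -> R) (sl rl : R) :
  s u @[u --> +oo] --> sl -> r u @[u --> +oo] --> rl ->
  J ((b u + s u / w (b u)) * cos h) ((b u + r u / w (b u)) * cos h) / S 1 1 u
    @[u --> +oo] --> expR (- ((sl + rl) / 2)).
Proof.
move=> ssl rrl.
have l0 : (pi * tan h)^-1 != 0 by rewrite invr_eq0 gt_eqF// mulr_gt0.
have <- : (2 * pi)^-1 * (2 / tan h * expR (- ((sl + rl) / 2))) / (pi * tan h)^-1 =
  expR (- ((sl + rl) / 2)).
  by rewrite (mulrA (2 * pi)^-1) div_2pi_tan// mulrAC divff ?mul1r.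
apply: (cvg_trans _ (cvgM (joint_cvg b_cvgy ssl rrl) (cvgV l0 joint_diag_cvg))).
apply: near_eq_cvg; near=> u.
have n0 : 0 < norm u by near: u; exact: norm_gt0.
have : 0 < S 1 1 u / norm u.
  by near: u; apply: (cvgr_gt _ joint_diag_cvg); rewrite invr_gt0 mulr_gt0.
rewrite pmulr_lgt0 ?invr_gt0// => S0.
rewrite /= -/(norm u); move: (norm u) (S 1 1 u) n0 S0 => N0 S0 n0 s0.
by field; rewrite !gt_eqF.
Unshelve. all: by end_near. Qed.

Let S11_gt0 : \forall u \near +oo, 0 < S 1 1 u.
Proof.
near=> u; have n0 : 0 < norm u by near: u; exact: norm_gt0.
have : 0 < S 1 1 u / norm u.
  by near: u; apply: (cvgr_gt _ joint_diag_cvg); rewrite invr_gt0 mulr_gt0.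
by rewrite pmulr_lgt0 ?invr_gt0.
Unshelve. all: by end_near. Qed.

(* When [w (a * u) / w u] diverges, a shift of the marginal quantile on its own
   scale [1 / w (q 1 u)] exceeds every multiple of the scale [1 / w (b u)] of the
   joint tail. *)
Lemma quantile_below (x z : R) : w (a * u) / w u @[u --> +oo] --> +oo ->
  1 < x -> \forall u \near +oo, q x u <= (b u + (- z) / w (b u)) * cos h.
Proof.
move=> woo x1; have x0 : 0 < x by lra.
have lx : 0 < ln x by rewrite ln_gt0.
have q1oo := q_cvgy ltr01.
have wqoo := cvg_comp _ _ q1oo woo.
have lim : - ln x < - (ln x / 2) by lra.
near=> u.
have q0 : 0 < q 1 u by near: u; exact: (q1oo _ (nbhs_pinfty_gt (num_real _))).
have wq := FG.1 _ q0.
have wb : 0 < w (b u) by apply: FG.1; rewrite mulr_gt0.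
have h1 : w (q 1 u) * (q x u - q 1 u) < - (ln x / 2).
  by near: u; exact: (cvgr_lt _ (@quantile_shift x x0) _ lim).
(* Beyond this threshold the joint shift [z * cos h / w (b u)] is less than half of the marginal
   shift [ln x / w (q 1 u)]. *)
have h2 : 2 * (z * cos h) / ln x < w (b u) / w (q 1 u).
  by near: u; exact: (wqoo _ (nbhs_pinfty_gt (num_real _))).
rewrite mulrDl bcos -lerBlDl mulNr mulNr mulrAC.
apply: (@le_trans _ _ (- (ln x / 2 / w (q 1 u)))).
  by rewrite -mulNr ler_pdivlMr// mulrC ltW.
rewrite lerN2 ler_pdivrMr//.
by move: h2; rewrite ltr_pdivrMr// => h2; lra.
Unshelve. all: by end_near. Qed.

Lemma quantile_above (x z : R) : w (a * u) / w u @[u --> +oo] --> +oo ->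
  0 < x < 1 -> \forall u \near +oo, (b u + z / w (b u)) * cos h <= q x u.
Proof.
move=> woo /andP[x0 x1].
have lx : ln x < 0 by rewrite ln_lt0// x0.
have q1oo := q_cvgy ltr01.
have wqoo := cvg_comp _ _ q1oo woo.
have lim : - (ln x / 2) < - ln x by lra.
near=> u.
have q0 : 0 < q 1 u by near: u; exact: (q1oo _ (nbhs_pinfty_gt (num_real _))).
have wq := FG.1 _ q0.
have wb : 0 < w (b u) by apply: FG.1; rewrite mulr_gt0.
have h1 : - (ln x / 2) < w (q 1 u) * (q x u - q 1 u).
  by near: u; exact: (cvgr_gt _ (@quantile_shift x x0) _ lim).
have h2 : 2 * (z * cos h) / - ln x < w (b u) / w (q 1 u).
  by near: u; exact: (wqoo _ (nbhs_pinfty_gt (num_real _))).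
rewrite mulrDl bcos -lerBrDl mulrAC.
apply: (@le_trans _ _ (- (ln x / 2) / w (q 1 u))); last first.
  by rewrite ler_pdivrMr// [leRHS]mulrC ltW.
have lx' : 0 < - ln x by lra.
rewrite ler_pdivrMr//.
by move: h2; rewrite ltr_pdivrMr// => h2; lra.
Unshelve. all: by end_near. Qed.

(** Both quantiles eventually fall below the centre shifted by - z, for every z; there the ratio
    tends to exp z, which exceeds [K] for z = |K|. *)
Lemma joint_ratio_cvgy (x y : R) : w (a * u) / w u @[u --> +oo] --> +oo ->
  1 < x -> 1 < y -> S x y u / S 1 1 u @[u --> +oo] --> +oo.
Proof.
move=> woo x1 y1; apply/cvgryPge => K; pose z := `|K|.
have Kz : K < expR (- ((- z + - z) / 2)).
  have -> : - ((- z + - z) / 2) = z by field.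
  have := expR_ge1Dx z; have := ler_norm K; rewrite /z; lra.
near=> u.
have S0 : 0 < S 1 1 u by near: u; exact: S11_gt0.
have qx : q x u <= (b u + (- z) / w (b u)) * cos h by near: u; exact: quantile_below.
have qy : q y u <= (b u + (- z) / w (b u)) * cos h by near: u; exact: quantile_below.
apply: le_trans (ltW _) (ler_wpM2r (ltW _) (J_ni qx qy)); last by rewrite invr_gt0.
by near: u; exact: (cvgr_gt _ (joint_shift_ratio (@cst_cvg (- z)) (@cst_cvg (- z))) _ Kz).
Unshelve. all: by end_near. Qed.

Lemma joint_ratio_cvg0 (x y : R) : w (a * u) / w u @[u --> +oo] --> +oo ->
  0 < x < 1 -> 0 < y < 1 -> S x y u / S 1 1 u @[u --> +oo] --> 0.
Proof.
move=> woo x01 y01; apply/cvgrPdist_lt => e e0; pose z := e^-1.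
have ez : expR (- ((z + z) / 2)) < e.
  have -> : - ((z + z) / 2) = - z by field.
  rewrite expRN invf_plt ?posrE ?expR_gt0//.
  by have := expR_ge1Dx z; rewrite /z; lra.
near=> u.
have S0 : 0 < S 1 1 u by near: u; exact: S11_gt0.
have qx : (b u + z / w (b u)) * cos h <= q x u by near: u; exact: quantile_above.
have qy : (b u + z / w (b u)) * cos h <= q y u by near: u; exact: quantile_above.
have Sxy0 : 0 <= S x y u by exact/ltW/joint_pos.
rewrite sub0r normrN ger0_norm; last by rewrite divr_ge0// ltW.
have Si0 : 0 <= (S 1 1 u)^-1 by rewrite invr_ge0 ltW.
apply: le_lt_trans (ler_wpM2r Si0 (J_ni qx qy)) _.
by near: u; exact: (cvgr_lt _ (joint_shift_ratio (@cst_cvg z) (@cst_cvg z)) _ ez).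
Unshelve. all: by end_near. Qed.

(** [l] converts the marginal scale to the joint one and [a] undoes the factor cos h, so the
    marginal shift - ln x becomes the joint shift - a l ln x. *)
Lemma joint_ratio_cvg (l x y : R) : w (a * u) / w u @[u --> +oo] --> l ->
  0 < x -> 0 < y ->
  S x y u / S 1 1 u @[u --> +oo] --> expR (a * l * (ln x + ln y) / 2).
Proof.
move=> wl x0 y0; have q1oo := q_cvgy ltr01.
have wql := cvg_comp _ _ q1oo wl.
pose s x u := a * (w (b u) / w (q 1 u)) * (w (q 1 u) * (q x u - q 1 u)).
have sl z : 0 < z -> s z u @[u --> +oo] --> a * l * - ln z.
  move=> z0; apply: cvgM; last exact: quantile_shift.
  by apply: cvgM; [exact: cvg_cst|exact: wql].
have := joint_shift_ratio (sl x x0) (sl y y0).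
have -> : - ((a * l * - ln x + a * l * - ln y) / 2) = a * l * (ln x + ln y) / 2 by field.
apply: cvg_trans; apply: near_eq_cvg; near=> u.
have q0 : 0 < q 1 u by near: u; exact: (q1oo _ (nbhs_pinfty_gt (num_real _))).
have wq := FG.1 _ q0.
have wb : 0 < w (b u) by apply: FG.1; rewrite mulr_gt0.
have sE z : (b u + s z u / w (b u)) * cos h = q z u.
  by rewrite mulrDl bcos /s /a; field; rewrite !gt_eqF.
by rewrite /= !sE.
Unshelve. all: by end_near. Qed.

End Asymptotics.

(** * The elliptical model *)

Section Model.
Context {R : realType} {d d' : measure_display} {T : measurableType d}.
Variables (P : probability T R) (X1 X2 : {RV P >-> R}).
Variables (T' : measurableType d') (P' : probability T' R).
Variables (rad U1 U2 : {RV P' >-> R}) (rho : R).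
Hypothesis rho_itv : -1 < rho < 1.
Hypothesis indep : independent_of P' rad (fun t => (U1 t, U2 t)).
Hypothesis unif : uniform_on_unit_circle U1 U2.
Hypothesis law : eq_in_distribution P (fun t => (X1 t, X2 t))
    P' (fun t => (rad t * U1 t,
                  rad t * (rho * U1 t + Num.sqrt (1 - rho ^+ 2) * U2 t))).
Let F := rcdf rad.
Hypothesis F0 : F 0 = 0.
Hypothesis F_lt1 : forall x, 0 < x -> F x < 1.
Let Q := rcdf X1.
Let h := acos rho / 2.

Lemma half_angle_itv : 0 < h < pi / 2.
Proof.
have /andP[r1 r2] := rho_itv.
have := acos_gt0 (x := rho); have := acos_ltpi (x := rho).
rewrite (ltW r1) r1 r2 (ltW r2) /h => /(_ isT) ? /(_ isT) ?.
by apply/andP; split; lra.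
Qed.

Let pi0 : 0 < pi :> R := pi_gt0 R.

Lemma cos_half_angle_gt0 : 0 < cos h.
Proof.
by apply: cos_gt0_pihalf; have := half_angle_itv => /andP[? ?]; apply/andP; split; lra.
Qed.

Lemma sin_half_angle_gt0 : 0 < sin h.
Proof.
by apply: sin_gt0_pi; have := half_angle_itv => /andP[? ?]; apply/andP; split; lra.
Qed.

Lemma rho_half_angle : rho = 2 * cos h ^+ 2 - 1.
Proof.
have /andP[r1 r2] := rho_itv.
rewrite -[LHS]acosK ?in_itv/= ?ltW// [in LHS](_ : acos rho = h *+ 2) ?cos_mulr2n ?mulr_natl//.
by rewrite /h; field.
Qed.

Lemma alpha_half_angle : alpha rho = (cos h)^-1.
Proof.
have c0 := cos_half_angle_gt0.
rewrite /alpha (_ : 2 / (1 + rho) = (cos h)^-1 ^+ 2); last first.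
  by rewrite {1}rho_half_angle addrCA subrr addr0 invfM mulrA divff ?mul1r ?exprVn.
by rewrite sqrtr_sqr gtr0_norm// invr_gt0.
Qed.

Lemma radial_le0 x : x <= 0 -> F x = 0.
Proof.
by move=> x0; apply/eqP; rewrite eq_le rcdf_ge0 andbT -F0 rcdf_nondecreasing.
Qed.

Lemma radial_lt1 x : F x < 1.
Proof. by have [/radial_le0->//|/F_lt1] := leP x 0. Qed.

Definition joint_exceedance (x y : R) : R :=
  fine (P' [set t | x < rad t * U1 t /\
    y < rad t * (rho * U1 t + Num.sqrt (1 - rho ^+ 2) * U2 t)]).

Let J := joint_exceedance.

Let fine_EFinM (c : R) (e : \bar R) : 0 < c -> fine (c%:E * e)%E = c * fine e.
Proof.
move=> c0; case: e => [r| |] //=; first by rewrite mulr0 gt0_muley ?lte_fin.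
by rewrite mulr0 gt0_muleNy ?lte_fin.
Qed.

Let measurable_exceedance (x y p r : R) :
  measurable [set t | x < rad t * U1 t /\ y < rad t * (p * U1 t + r * U2 t)].
Proof.
apply: measurableI; rewrite -[X in measurable X]setTI.
  by apply: measurable_fun_ltr => //; exact: measurable_funM.
apply: measurable_fun_ltr => //; apply: measurable_funM => //.
by apply: measurable_funD; exact: measurable_funM.
Qed.

Lemma joint_exceedanceE x y : 0 < x -> 0 < y ->
  J x y = (2 * pi)^-1 * wedge_integral F h x y.
Proof.
move=> x0 y0; have /andP[r1 r2] := rho_itv.
have r11 : -1 <= rho <= 1 by rewrite !ltW.
have := @polar_sector_prob _ _ _ _ _ _ _ indep unif F0 (acos rho) x y.
rewrite acos_ge0// acos_lepi// acosK ?in_itv//= sin_acos// /J /joint_exceedance => -> //.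
by rewrite fine_EFinM// invr_gt0 mulr_gt0.
Qed.

Lemma joint_exceedance_ni x1 x2 y1 y2 : x1 <= x2 -> y1 <= y2 -> J x2 y2 <= J x1 y1.
Proof.
move=> x12 y12; apply: fine_le; rewrite ?fin_num_measure//.
apply: le_measure; rewrite ?inE//.
by move=> t /= [t1 t2]; split; [exact: le_lt_trans t1|exact: le_lt_trans t2].
Qed.

Let mfst_law (A : set R) : measurable A -> P (X1 @^-1` A) = P' [set t | A (rad t * U1 t)].
Proof.
move=> mA; apply: (law (A := fst @^-1` A)).
by rewrite -[X in measurable X]setTI; apply: measurable_fst.
Qed.

Lemma marginal_atomless a : 0 < a -> P [set t | X1 t = a] = 0%E.
Proof.
move=> a0; rewrite -(polar_abscissa_atomless indep unif a0).
exact: (mfst_law (measurable_set1 a)).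
Qed.

Lemma marginal_increasing x y : 0 < x -> x < y -> Q x < Q y.
Proof.
move=> x0 xy; rewrite -lte_fin -!rcdfE.
have -> : cdf X1 y = (cdf X1 x + P (X1 @^-1` `]x, y]))%E.
  rewrite -measureU//.
  - congr (P _); apply/seteqP; split => t /=; rewrite !in_itv/=.
      by move=> ty; have [tx|tx] := leP (X1 t) x; [left|right].
    by move=> [/le_trans|/andP[]//]; apply; exact: ltW.
  - apply/seteqP; split => t //= []; rewrite !in_itv/= => h1 /andP[h2 _].
    by move: (le_lt_trans h1 h2); rewrite ltxx.
rewrite -[X in (X < _)%E]adde0 lteD2lE ?fin_num_measure// mfst_law//.
rewrite (_ : [set t | _] = [set t | (x < rad t * U1 t <= y)%R]); last first.
  by apply/seteqP; split => t /=; rewrite in_itv.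
exact: (polar_abscissa_itv_gt0 indep unif radial_lt1).
Qed.

Let H x := 1 - Q x.

Lemma marginal_tailE x : 0 < x -> H x = (2 * pi)^-1 * wedge_integral F 0 x x.
Proof.
move=> x0; rewrite -fine_EFinM; last by rewrite invr_gt0 mulr_gt0.
have := @polar_sector_prob _ _ _ _ _ _ _ indep unif F0 0 x x.
rewrite lexx ltW// mul0r => <- //.
rewrite /H /Q -[LHS]/(fine (1 - Q x)%:E) EFinB -rcdfE -ccdf_1_cdf.
congr (fine _); rewrite /ccdf/distribution/pushforward mfst_law//; congr (P' _).
apply/seteqP; split => t /=; rewrite in_itv/= andbT cos0 sin0 mul1r mul0r addr0.
  by [].
by case.
Qed.

Lemma marginal_tail_ni x y : x <= y -> H y <= H x.
Proof. by move=> xy; rewrite lerD2l lerN2 rcdf_nondecreasing. Qed.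

Lemma marginal_tail_gt0 x : 0 < H x.
Proof.
rewrite subr_gt0; have m0 : 0 < `|x| + 1 by have := normr_ge0 x; lra.
apply: (@le_lt_trans _ _ (Q (`|x| + 1))).
  by rewrite rcdf_nondecreasing//; have := ler_norm x; lra.
apply: (lt_le_trans (marginal_increasing m0 _) (rcdf_le1 X1 (`|x| + 1 + 1))); lra.
Qed.

Let q x u := cdf_inverse Q (1 - x / u).

Lemma quantile_near (A x : R) : 0 < A -> 0 < x -> \forall u \near +oo,
  [/\ A < q x u, Q (q x u) = 1 - x / u & forall t, (1 - x / u < Q t) = (q x u < t)].
Proof.
move=> A0 x0; have HA := marginal_tail_gt0 A.
near=> u; have u0 : 0 < u by near: u; exact: (nbhs_pinfty_gt (num_real _)).
apply: cdf_inverse_spec => //; [exact: marginal_atomless|exact: marginal_increasing| |].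
  have : x / H A < u by near: u; exact: (nbhs_pinfty_gt (num_real _)).
  by rewrite ltr_pdivrMr// mulrC -ltr_pdivrMr// => xu; rewrite ltrBrDr -ltrBrDl.
by rewrite gtrBl divr_gt0.
Unshelve. all: by end_near. Qed.

Lemma quantile_cvgy x : 0 < x -> q x u @[u --> +oo] --> +oo.
Proof.
move=> x0; apply/cvgryPge => K.
have K0 : 0 < `|K| + 1 by have := normr_ge0 K; lra.
apply: filterS (quantile_near K0 x0) => u [h1 _ _].
by have := ler_norm K; lra.
Qed.

Lemma quantile_tail x : 0 < x -> \forall u \near +oo, H (q x u) = x / u.
Proof.
move=> x0; apply: filterS (quantile_near ltr01 x0) => u [_ e _].
by rewrite /H e opprB addrC subrK.
Qed.

Lemma joint_tail_quantile x y : 0 < x -> 0 < y ->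
  \forall u \near +oo, joint_tail X1 X2 x y u = J (q x u) (q y u).
Proof.
move=> x0 y0; apply: filterS2 (quantile_near ltr01 x0) (quantile_near ltr01 y0).
move=> u [_ _ hx] [_ _ hy]; rewrite /joint_tail /J /joint_exceedance; congr (fine _).
rewrite -(law (A := [set v | q x u < v.1 /\ q y u < v.2])).
  by congr (P _); apply/seteqP; split => t /=; rewrite -/Q hx hy.
apply: measurableI; rewrite -[X in measurable X]setTI.
  by apply: measurable_fun_ltr => //; exact: measurable_fst.
by apply: measurable_fun_ltr => //; exact: measurable_snd.
Qed.

(** Regular variation asks for positivity at every u > 0, including small u for which 1 - x / u is
    not in ]0, 1[ and the quantile is meaningless; a fixed far quadrant is contained in the event
    instead. *)
Lemma joint_tail_ge (x y u : R) : 0 < u -> 0 < x -> 0 < y ->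
  exists2 A, 0 < A & J A A <= joint_tail X1 X2 x y u.
Proof.
move=> u0 x0 y0.
have p0 : 0 < Num.min (x / u) (y / u) by rewrite lt_min !divr_gt0.
have [M [_ HM]] := cvgr_lt _ (rcdf_cvg1 X1) _ p0.
pose A := `|M| + 1; have := ler_norm M => MM; have := normr_ge0 M => M0.
have MA : M < A by rewrite /A; lra.
have := HM A MA; rewrite lt_min => /andP[hx hy].
exists A; first by rewrite /A; lra.
rewrite /J /joint_exceedance -(law (A := [set v | A < v.1 /\ A < v.2])); last first.
  apply: measurableI; rewrite -[X in measurable X]setTI.
    by apply: measurable_fun_ltr => //; exact: measurable_fst.
  by apply: measurable_fun_ltr => //; exact: measurable_snd.
have mQ (Y : {RV P >-> R}) (p : R) : measurable [set t | p < Q (Y t)].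
  rewrite -[X in measurable X]setTI; apply: measurable_fun_ltr => //.
  apply: (@measurableT_comp _ _ _ _ _ _ Q) => //.
  by apply: nondecreasing_measurable => //; exact: rcdf_nondecreasing.
have mX (Y : {RV P >-> R}) (p : R) : measurable [set t | p < Y t].
  by rewrite -[X in measurable X]setTI; exact: measurable_fun_ltr.
apply: fine_le; rewrite ?fin_num_measure//=.
- by apply: measurableI; exact: mX.
- by apply: measurableI; exact: mQ.
apply: le_measure; rewrite ?inE/=.
- by apply: measurableI; exact: mX.
- by apply: measurableI; exact: mQ.
have QA := rcdf_nondecreasing X1.
move=> t /= [/ltW/QA t1 /ltW/QA t2]; rewrite -/Q in t1 t2 hx hy *; split; lra.
Qed.

End Model.

(* The constant of part (iii) in terms of half the angle between the directions
   of X1 and X2, for which 1 - rho^2 = (2 cos h sin h)^2. *)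
Lemma limit_constantE {R : realType} (h rho : R) : 0 < cos h -> 0 < sin h ->
  rho = 2 * cos h ^+ 2 - 1 ->
  (cos h)^-1 ^+ 2 * (1 - rho ^+ 2) `^ (3 / 2) / (2 * pi * (1 - rho) ^+ 2) = (pi * tan h)^-1.
Proof.
move=> c0 s0 rhoE.
have rhoE' : 1 - rho = 2 * sin h ^+ 2 by rewrite rhoE sin2cos2; ring.
have -> : (1 - rho ^+ 2) `^ (3 / 2) = (2 * cos h * sin h) ^+ 3.
  have -> : 1 - rho ^+ 2 = (2 * cos h * sin h) `^ 2.
    rewrite -[2 in RHS]/(2%:R) powR_mulrn; last by rewrite !mulr_ge0// ltW.
    rewrite -[1](expr1n _ 2) subr_sqr rhoE' rhoE; ring.
  rewrite -powRrM (_ : 2 * (3 / 2) = 3%:R); last by field.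
  by rewrite powR_mulrn// !mulr_ge0// ltW.
rewrite rhoE' /tan.
have p0 := pi_gt0 R; move: pi (cos h) (sin h) p0 c0 s0 => p c s p0 c0 s0.
by field; rewrite !gt_eqF.
Qed.

Theorem theorem2p1 (R : realType) (d d' : measure_display)
    (T : measurableType d) (P : probability T R) (X1 X2 : {RV P >-> R})
    (T' : measurableType d') (P' : probability T' R)
    (rad U1 U2 : {RV P' >-> R}) (rho : R) (w : R -> R) :
  -1 < rho < 1 ->
  {ae P', forall t, 0 < rad t} ->
  independent_of P' rad (fun t => (U1 t, U2 t)) ->
  uniform_on_unit_circle U1 U2 ->
  eq_in_distribution P (fun t => (X1 t, X2 t))
    P' (fun t => (rad t * U1 t,
                  rad t * (rho * U1 t + Num.sqrt (1 - rho ^+ 2) * U2 t))) ->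
  let F := rcdf rad in
  F 0 = 0 ->
  (forall x, 0 < x -> F x < 1) ->
  gumbel_mda F w ->
  let Q := rcdf X1 in
  let b := fun u => alpha rho * cdf_inverse Q (1 - 1 / u) in
  [/\ w (alpha rho * u) / w u @[u --> +oo] --> +oo ->
        (forall x y, 1 < x -> 1 < y ->
           joint_tail_ratio X1 X2 x y u @[u --> +oo] --> +oo) /\
        (forall x y, 0 < x < 1 -> 0 < y < 1 ->
           joint_tail_ratio X1 X2 x y u @[u --> +oo] --> 0),
      forall theta, 0 <= theta ->
        (forall c, 0 < c ->
           w (c * u) / w u @[u --> +oo] --> c `^ (theta - 1)) ->
        let eta := ((1 + rho) / 2) `^ (theta / 2) in
        [/\ eta = alpha rho `^ (- theta),
            0 < eta <= 1,
            forall x y, 0 < x -> 0 < y ->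
              joint_tail_ratio X1 X2 x y u @[u --> +oo]
                --> (x * y) `^ (1 / (2 * eta)) &
            regularly_varying (joint_tail X1 X2 1 1) (- (1 / eta))] &
      exists2 eps : R -> R, eps u @[u --> +oo] --> 0 &
        \forall u \near +oo,
          joint_tail X1 X2 1 1 u =
            (1 + eps u)
            * (alpha rho ^+ 2 * (1 - rho ^+ 2) `^ (3 / 2)
                 / (2 * pi * (1 - rho) ^+ 2))
            * ((1 - F (b u)) / (b u * w (b u)))].
Proof.
move=> rho_itv _ indep unif law F F0 F_lt1 FG Q b.
pose h := acos rho / 2; pose q x u := cdf_inverse Q (1 - x / u).
pose J := joint_exceedance rad U1 U2 rho.
have h_itv : 0 < h < pi / 2 by exact: half_angle_itv.
have ch : 0 < cos h by exact: cos_half_angle_gt0.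
have sh : 0 < sin h by exact: sin_half_angle_gt0.
have th : 0 < tan h by exact: divr_gt0.
have alphaE : alpha rho = (cos h)^-1 by exact: alpha_half_angle.
have a1 := alpha_gt1 rho_itv.
have a0 : 0 < alpha rho by lra.
have Fnd : {homo F : x y / x <= y} by exact: rcdf_nondecreasing.
have F_le0 := radial_le0 F0.
have F_lt1' := radial_lt1 F0 F_lt1.
have tail0 : 1 - F u @[u --> +oo] --> 0 by exact: rcdf_cvg1.
have JE := joint_exceedanceE rho_itv indep unif F0.
have HE := marginal_tailE indep unif law F0.
have J_ni := @joint_exceedance_ni R d' T' P' rad U1 U2 rho.
have H_ni := @marginal_tail_ni R d T P X1.
have H_gt0 := marginal_tail_gt0 indep unif law F0 F_lt1.
have q_oo : forall x, 0 < x -> q x u @[u --> +oo] --> +oo.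
  exact: (quantile_cvgy indep unif law F0 F_lt1).
have qH : forall x, 0 < x -> \forall u \near +oo, 1 - Q (q x u) = x / u.
  exact: (quantile_tail indep unif law F0 F_lt1).
have jt x y : 0 < x -> 0 < y ->
    \forall u \near +oo, joint_tail X1 X2 x y u = J (q x u) (q y u).
  exact: (joint_tail_quantile indep unif law F0 F_lt1).
have jr x y : 0 < x -> 0 < y -> \forall u \near +oo,
    J (q x u) (q y u) / J (q 1 u) (q 1 u) = joint_tail_ratio X1 X2 x y u.
  by move=> x0 y0; apply: filterS2 (jt x y x0 y0) (jt 1 1 ltr01 ltr01) => u;
    rewrite /joint_tail_ratio => -> ->.
split.
- rewrite alphaE => woo; split=> x y x1 y1.
    have [x0 y0] : 0 < x /\ 0 < y by split; lra.
    apply: (cvg_trans (near_eq_cvg (jr x y x0 y0))).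
    exact: (joint_ratio_cvgy Fnd F_le0 F_lt1' tail0 FG h_itv JE HE J_ni H_ni H_gt0 q_oo qH).
  have [/andP[x0 _] /andP[y0 _]] := (x1, y1).
  apply: (cvg_trans (near_eq_cvg (jr x y x0 y0))).
  exact: (joint_ratio_cvg0 Fnd F_le0 F_lt1' tail0 FG h_itv JE HE J_ni H_ni H_gt0 q_oo qH).
- move=> theta theta0 wtheta eta.
  have aE : (1 + rho) / 2 = alpha rho `^ (- 2%:R).
    rewrite powRN powR_mulrn ?ltW// /alpha sqr_sqrtr ?invf_div// divr_ge0//.
    by have /andP[] := rho_itv; lra.
  have etaE : eta = alpha rho `^ (- theta).
    by rewrite /eta aE -powRrM; congr (_ `^ _); field.
  have eta_gt0 : 0 < eta by rewrite etaE powR_gt0.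
  have etaV : eta^-1 = alpha rho `^ theta by rewrite etaE powRN invrK.
  have lim x y : 0 < x -> 0 < y ->
      joint_tail_ratio X1 X2 x y u @[u --> +oo] --> (x * y) `^ (1 / (2 * eta)).
    move=> x0 y0; apply: (cvg_trans (near_eq_cvg (jr x y x0 y0))).
    have wa : w ((cos h)^-1 * u) / w u @[u --> +oo] --> alpha rho `^ (theta - 1).
      by rewrite -alphaE; exact: wtheta.
    (* The factor from the angle and the one from [w] combine to alpha * alpha^(theta - 1) =
       alpha^theta = 1 / eta. *)
    have -> : (x * y) `^ (1 / (2 * eta)) =
        expR ((cos h)^-1 * alpha rho `^ (theta - 1) * (ln x + ln y) / 2).
      rewrite -alphaE {1}/powR gt_eqF ?mulr_gt0// lnM ?posrE//; congr (expR _).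
      have -> : alpha rho * alpha rho `^ (theta - 1) = alpha rho `^ theta.
        rewrite -[X in X * _]powRr1 ?ltW// -powRD.
          by rewrite addrC subrK.
        by rewrite (gt_eqF a0) implybT.
      by rewrite div1r invfM etaV; ring.
    exact: (joint_ratio_cvg Fnd F_le0 F_lt1' tail0 FG h_itv JE HE H_ni H_gt0 q_oo qH wa x0 y0).
  split => //.
  + rewrite eta_gt0 -invf_ge1// etaV.
    by rewrite -[leLHS](powRr0 (alpha rho)) ler_powR// ltW.
  + split.
      move=> u u0.
      have [A A0] := joint_tail_ge law u0 ltr01 ltr01.
      apply: lt_le_trans.
      exact: (joint_pos Fnd F_le0 F_lt1' tail0 FG h_itv JE J_ni).
    move=> c c0.
    have ci0 : 0 < c^-1 by rewrite invr_gt0.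
    (* Since 1 / (c u) = c^-1 / u, the joint tail at c u for levels (1, 1) is the one at u for
       levels (1/c, 1/c). *)
    have := lim _ _ ci0 ci0.
    have -> : (c^-1 * c^-1) `^ (1 / (2 * eta)) = c `^ (- (1 / eta)).
      have -> : c^-1 * c^-1 = c `^ (-1 - 1).
        by rewrite powRD ?powR_inv1 ?ltW// (gt_eqF c0) implybT.
      rewrite -powRrM; congr (_ `^ _).
      by field; rewrite gt_eqF.
    apply: cvg_trans; apply: near_eq_cvg; apply: nearW => u.
    by rewrite /joint_tail_ratio /joint_tail !div1r invfM.
- pose C := alpha rho ^+ 2 * (1 - rho ^+ 2) `^ (3 / 2) / (2 * pi * (1 - rho) ^+ 2).
  have CE : C = (pi * tan h)^-1.
    by rewrite /C alphaE; apply: limit_constantE => //; exact: rho_half_angle.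
  have C0 : 0 < C by rewrite CE invr_gt0 mulr_gt0// pi_gt0.
  have diag := joint_diag_cvg Fnd F_le0 F_lt1' tail0 FG h_itv JE q_oo.
  have b_oo : b u @[u --> +oo] --> +oo by exact: gt0_cvgMry a0 (q_oo 1 ltr01).
  pose D u := (1 - F (b u)) / (b u * w (b u)).
  (* With the exact relative error as witness, the identity only needs [C * D u] to be nonzero, and
     the analytic content is that the error vanishes. *)
  exists (fun u => joint_tail X1 X2 1 1 u / (C * D u) - 1).
    have Cn0 : C != 0 by rewrite gt_eqF.
    have : joint_tail X1 X2 1 1 u / D u / C - 1 @[u --> +oo] --> (pi * tan h)^-1 / C - 1.
      apply: cvgB; last exact: cvg_cst.
      apply: cvgM; last exact: cvg_cst.
      apply: cvg_trans diag; apply: near_eq_cvg.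
      apply: filterS (jt 1 1 ltr01 ltr01) => u ->.
      by rewrite /D /b alphaE; congr (_ / _); exact: mulrC.
    rewrite -CE divff// subrr; apply: cvg_trans; apply: near_eq_cvg; apply: nearW => u.
    by rewrite (mulrC C) (invfM (D u) C) mulrA.
  near=> u.
  have b0 : 0 < b u by near: u; exact: (b_oo _ (nbhs_pinfty_gt (num_real _))).
  have D0 : D u != 0.
    by rewrite gt_eqF// divr_gt0 ?subr_gt0// mulr_gt0// FG.1.
  rewrite -/C -/(D u) addrCA subrr addr0 -mulrA divfK//.
  by rewrite mulf_neq0// gt_eqF.
Unshelve. all: by end_near. Qed.
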